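(* For any sequence $\omega=\{q_n\}_{n=1}^{\infty}$ of numbers in $(0,1)$, let $E(\omega)\subset[0,1]$ be the generalized Cantor set for $\omega$, let $X_{E(\omega)}=\hat{\mathbb{C}}\setminus E(\omega)$, and let $\Gamma$ be the torsion-free Fuchsian group acting on the unit disk $\mathbb{D}$ with $X_{E(\omega)}=\mathbb{D}/\Gamma$. Then $\Gamma$ is of the first kind.
   Context: Generalized Cantor set: Let $\omega=\{q_n\}_{n=1}^{\infty}$ be a sequence in $(0,1)$ and $I=[0,1]\subset\mathbb{R}$. First remove from $I$ an open interval of length $q_1$ so that the two remaining closed intervals $I_1^1,I_1^2$ have the same length. Inductively, for $n\ge 2$, remove from each $I_{n-1}^i$ ($i=1,\dots,2^{n-1}$) an open interval of length $q_n|I_{n-1}^1|$ so that the remaining $2^n$ closed intervals $I_n^1,\dots,I_n^{2^n}$ all have the same length ($|\cdot|$ denotes length). Put $E_n=\bigcup_{i=1}^{2^n}I_n^i$ and $E(\omega)=\bigcap_{n=1}^{\infty}E_n$. The set $X_{E(\omega)}=\hat{\mathbb{C}}\setminus E(\omega)$ is regarded as a hyperbolic Riemann surface, where $\hat{\mathbb{C}}$ is the Riemann sphere. A Fuchsian group $\Gamma$ acting on $\mathbb{D}$ is of the first kind if its limit set $\Lambda(\Gamma)$ coincides with the unit circle $\partial\mathbb{D}$. *)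

(* Defs.v *)
From HB Require Import structures.
From mathcomp Require Import all_boot all_order all_algebra.
From mathcomp Require Import all_classical all_reals all_analysis.
From mathcomp Require Import complex.
Set Implicit Arguments.
Unset Strict Implicit.
Unset Printing Implicit Defensive.
Import Order.TTheory GRing.Theory Num.Theory.
Import numFieldNormedType.Exports.
Local Open Scope classical_set_scope.
Local Open Scope ring_scope.
Local Open Scope complex_scope.

(* Sequences are indexed from 1: the value [q 0] is never used. *)
Fixpoint cantor_intervals (R : realType) (q : nat -> R) (n : nat) :
    seq (R * R) :=
  if n is m.+1 then
    flatten [seq let side := (1 - q n) / 2 * (ab.2 - ab.1) in
                 [:: (ab.1, ab.1 + side); (ab.2 - side, ab.2)]
            | ab <- cantor_intervals q m]
  else [:: (0, 1)].

Definition cantor_level (R : realType) (q : nat -> R) (n : nat) : set R :=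
  [set x | exists2 ab, ab \in cantor_intervals q n & ab.1 <= x <= ab.2].

Definition cantor_set (R : realType) (q : nat -> R) : set R :=
  \bigcap_(n in [set n | (1 <= n)%N]) cantor_level q n.

(* Naming the field structure of R[i] lets the library infer its topology. *)
Definition cplx (R : realType) : numClosedFieldType := R[i].

(* The Riemann sphere; [Some z] is the finite point z and [None] is infinity. *)
Definition sphere (R : realType) : topologicalType :=
  one_point_compactification (cplx R).

Definition cantor_complement (R : realType) (q : nat -> R) : set (sphere R) :=
  ~` [set (Some x%:C : sphere R) | x in cantor_set q].

(* [chart p] is the standard chart around p (z if p is finite, 1/z if p is
   infinity) and [chart_inv p] its inverse. The value of [chart p] at the one point
   outside the domain of the chart is junk; it is harmless below because
   [holomorphic_at] demands continuity. *)
Definition chart (R : realType) (p x : sphere R) : cplx R :=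
  match p, x with
  | Some _, Some z => z
  | None, Some z => z^-1
  | _, None => 0
  end.

Definition chart_inv (R : realType) (p : sphere R) (z : cplx R) : sphere R :=
  if p is Some _ then Some z else if z == 0 then None else Some z^-1.

(* Complex differentiability at p, read in the charts around p and f p. *)
Definition holomorphic_at (R : realType) (f : sphere R -> sphere R)
    (p : sphere R) : Prop :=
  {for p, continuous f} /\
  derivable ((chart (f p) \o f \o chart_inv p) : cplx R -> cplx R) (chart p p) 1.

Definition unit_disk (R : realType) : set (sphere R) :=
  [set (Some z : sphere R) | z in [set z : cplx R | `|z| < 1]].

Definition unit_circle (R : realType) : set (sphere R) :=
  [set (Some z : sphere R) | z in [set z : cplx R | `|z| = 1]].

(* z |-> (a z + b) / (c z + d) for A = [a, b; c, d] *)
Definition mobius (R : realType) (A : 'M[cplx R]_2) (x : sphere R) : sphere R :=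
  let a := A 0 0 in let b := A 0 1 in let c := A 1 0 in let d := A 1 1 in
  match x with
  | Some z => if c * z + d == 0 then None
              else Some ((a * z + b) / (c * z + d))
  | None => if c == 0 then None else Some (a / c)
  end.

Definition transformation_group (R : realType)
    (Gamma : set (sphere R -> sphere R)) : Prop :=
  [/\ Gamma id,
      forall g h, Gamma g -> Gamma h -> Gamma (g \o h) &
      forall g, Gamma g ->
        exists h, [/\ Gamma h, cancel g h & cancel h g]].

(* Discreteness in PSL(2, C) = SL(2, C) / {1, -1} is discreteness of the
   preimage in SL(2, C). *)
Definition fuchsian (R : realType) (Gamma : set (sphere R -> sphere R)) :
    Prop :=
  [/\ transformation_group Gamma,
      forall g, Gamma g ->
        (exists2 A : 'M[cplx R]_2, \det A = 1 & g = mobius A) /\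
        g @` @unit_disk R = @unit_disk R &
      let G := [set A : 'M[cplx R]_2 | \det A = 1 /\ Gamma (mobius A)] in
      isolated G = G].

Definition torsion_free (R : realType) (Gamma : set (sphere R -> sphere R)) :
    Prop :=
  forall g n, Gamma g -> (0 < n)%N -> iter n g = id -> g = id.

Definition group_orbit (R : realType) (Gamma : set (sphere R -> sphere R))
    (x : sphere R) : set (sphere R) :=
  [set g x | g in Gamma].

Definition disk_quotient (R : realType)
    (Gamma : set (sphere R -> sphere R)) : set (set (sphere R)) :=
  group_orbit Gamma @` @unit_disk R.

(* X = D / Gamma as Riemann surfaces: there is a biholomorphic map Phi from
   D / Gamma onto the open set X. In the complex structure of the quotient, Phi
   is holomorphic when its composite with the projection [group_orbit Gamma] is, and
   Phi^-1 is holomorphic when it lifts locally to holomorphic maps s into the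
   disk. *)
Definition is_disk_quotient (R : realType) (X : set (sphere R))
    (Gamma : set (sphere R -> sphere R)) : Prop :=
  exists Phi : set (sphere R) -> sphere R,
    [/\ set_bij (disk_quotient Gamma) X Phi,
        forall z, unit_disk z -> holomorphic_at (Phi \o group_orbit Gamma) z &
        forall x, X x -> exists s : sphere R -> sphere R,
          \forall y \near x, [/\ holomorphic_at s y, unit_disk (s y) &
            Phi (group_orbit Gamma (s y)) = y]].

Definition limit_set (R : realType) (Gamma : set (sphere R -> sphere R)) :
    set (sphere R) :=
  [set x | exists2 z, unit_disk z & limit_point (group_orbit Gamma z) x].

Definition first_kind (R : realType) (Gamma : set (sphere R -> sphere R)) :
    Prop :=
  limit_set Gamma = @unit_circle R.

(* Main.v *)
Require Import Defs.
From mathcomp Require Import all_boot all_order all_algebra.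
From mathcomp Require Import all_classical all_reals all_analysis.
From mathcomp Require Import complex zify ring lra.
Set Implicit Arguments.
Unset Strict Implicit.
Unset Printing Implicit Defensive.
Import Order.TTheory GRing.Theory Num.Theory.
Import numFieldNormedType.Exports.
Local Open Scope classical_set_scope.
Local Open Scope ring_scope.

(** Discreteness puts the limit set inside the unit circle. Conversely, let zeta
    be a point of the circle near which the orbit of 0 does not accumulate, and
    compose the covering map D -> X with a Moebius map from the upper half-plane
    to D that sends 0 to zeta, to get a holomorphic map F. If F w lies near a
    point p of X, then the disk point is g v with g in Gamma and v in a compact
    set, hence close to g 0 when w is close to the real axis; so F leaves every
    compact subset of X as w approaches a segment of the real axis around 0.
    Since E(omega) is totally disconnected, the intermediate value theorem
    applied to the real part of F shows that F tends uniformly to a single point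
    c there. A holomorphic function with constant boundary values on a segment
    is constant, so F takes the value c, and c would have to be a point of X
    that F avoids.

    The last uniqueness principle is derived from Goursat's argument applied to
    trapezoidal sums, which replace contour integrals: they vanish in the limit
    on the boundary of a rectangle, and applied to (G(w) - G(0)) / w this bounds
    |G(0)| by a multiple of the maximum of |G| on the boundary. *)

(** * Real-valued modulus on the complex numbers *)

(** The norm of [cplx R] takes its values in [cplx R]; its real part lives in the totally ordered
    field [R], where the estimates below take place. *)
Definition modulus (R : realType) (z : cplx R) : R := complex.Re `|z|.

Section Modulus.
Variable R : realType.
Local Notation C := (cplx R).
Local Notation md := (@modulus R).
Implicit Types z w : C.

Lemma normE z : `|z| = (md z)%:C%C.
Proof. by rewrite /modulus normc_def. Qed.

Lemma modulus_sqr z : md z ^+ 2 = complex.Re z ^+ 2 + complex.Im z ^+ 2.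
Proof. by rewrite /modulus normc_def /= sqr_sqrtr // addr_ge0 ?sqr_ge0. Qed.

Lemma modulus_ge0 z : 0 <= md z.
Proof. by rewrite /modulus normc_def /= sqrtr_ge0. Qed.

Lemma modulus_eq0 z : (md z == 0) = (z == 0).
Proof. by rewrite -[RHS]normr_eq0 normE -(inj_eq (@complexI R)). Qed.

Lemma modulus0 : md 0 = 0.
Proof. by apply/eqP; rewrite modulus_eq0. Qed.

Lemma modulus_gt0 z : (0 < md z) = (z != 0).
Proof. by rewrite lt0r modulus_ge0 andbT modulus_eq0. Qed.

Lemma modulusM z w : md (z * w) = md z * md w.
Proof. by apply: (@complexI R); rewrite rmorphM /= -!normE normrM. Qed.

Lemma modulusV z : md z^-1 = (md z)^-1.
Proof. by apply: (@complexI R); rewrite fmorphV /= -!normE normfV. Qed.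

Lemma modulusX z n : md (z ^+ n) = md z ^+ n.
Proof. by apply: (@complexI R); rewrite rmorphXn /= -!normE normrX. Qed.

Lemma modulusN z : md (- z) = md z.
Proof. by apply: (@complexI R); rewrite -!normE normrN. Qed.

Lemma modulusB z w : md (z - w) = md (w - z).
Proof. by rewrite -modulusN opprB. Qed.

Lemma modulus1 : md 1 = 1.
Proof. by apply: (@complexI R); rewrite -normE normr1. Qed.

Lemma modulusD z w : md (z + w) <= md z + md w.
Proof. by rewrite -lecR rmorphD /= -!normE ler_normD. Qed.

Lemma modulusBD z w : md (z - w) <= md z + md w.
Proof. by rewrite -(modulusN w) modulusD. Qed.

Lemma modulus_triangle z x w : md (z - w) <= md (z - x) + md (x - w).
Proof. by have := modulusD (z - x) (x - w); rewrite addrA subrK. Qed.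

Lemma modulus_subr_le z w : md z - md w <= md (z - w).
Proof. by rewrite lerBlDr; have := modulusD (z - w) w; rewrite subrK. Qed.

Lemma modulus_real (x : R) : md (x%:C%C : C) = `|x|.
Proof. by rewrite /modulus normc_def /= expr0n /= addr0 sqrtr_sqr. Qed.

Lemma Re_le_modulus z : `|complex.Re z| <= md z.
Proof.
rewrite -(ler_pXn2r (n := 2)) ?nnegrE ?modulus_ge0 //.
by rewrite modulus_sqr real_normK ?num_real // lerDl sqr_ge0.
Qed.

Lemma Im_le_modulus z : `|complex.Im z| <= md z.
Proof.
rewrite -(ler_pXn2r (n := 2)) ?nnegrE ?modulus_ge0 //.
by rewrite modulus_sqr real_normK ?num_real // lerDr sqr_ge0.
Qed.

Lemma modulus_le_ReIm z : md z <= `|complex.Re z| + `|complex.Im z|.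
Proof.
rewrite -(ler_pXn2r (n := 2)) ?nnegrE ?modulus_ge0 ?addr_ge0 //.
rewrite modulus_sqr sqrrD !real_normK ?num_real //.
by rewrite -addrA (addrC (_ *+ 2)) addrA lerDl mulrn_wge0 // mulr_ge0.
Qed.

Lemma of_realM (x y : R) : ((x * y)%:C%C : C) = x%:C%C * y%:C%C.
Proof. exact: rmorphM. Qed.

Lemma of_realD (x y : R) : ((x + y)%:C%C : C) = x%:C%C + y%:C%C.
Proof. exact: rmorphD. Qed.

Lemma of_realB (x y : R) : ((x - y)%:C%C : C) = x%:C%C - y%:C%C.
Proof. exact: rmorphB. Qed.

Lemma of_real_half : ((2^-1 : R)%:C%C : C) = 2^-1.
Proof. by rewrite fmorphV rmorph_nat. Qed.

End Modulus.

(** * Bisection of the unit square *)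

Section Bisection.
Variables (R : realType) (good : R -> R -> R -> Prop).

Hypothesis good_quad : forall s t r, 0 < r ->
  0 <= s -> s + r <= 1 -> 0 <= t -> t + r <= 1 ->
  good s t (r / 2) -> good (s + r / 2) t (r / 2) ->
  good s (t + r / 2) (r / 2) -> good (s + r / 2) (t + r / 2) (r / 2) ->
  good s t r.
Hypothesis good_local : forall x y, 0 <= x <= 1 -> 0 <= y <= 1 ->
  exists2 d, 0 < d & forall s t r, 0 < r < d -> 0 <= s -> 0 <= t ->
    s <= x <= s + r -> t <= y <= t + r -> good s t r.

Let sub_square (a b : R * R) (r : R) : Prop :=
  [/\ a.1 <= b.1, b.1 + r / 2 <= a.1 + r, a.2 <= b.2 & b.2 + r / 2 <= a.2 + r].

Let in_unit (a : R * R) (r : R) : Prop :=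
  [/\ 0 <= a.1, a.1 + r <= 1, 0 <= a.2 & a.2 + r <= 1].

Let bad_child (a : R * R) (r : R) : 0 < r -> in_unit a r -> ~ good a.1 a.2 r ->
  exists b : R * R, sub_square a b r /\ ~ good b.1 b.2 (r / 2).
Proof.
case: a => s t /= r0 [/= s0 s1 t0 t1] bad; apply: contrapT => noc.
have gd (b : R * R) : sub_square (s, t) b r -> good b.1 b.2 (r / 2).
  by move=> sb; apply: contrapT => nb; apply: noc; exists b.
apply: bad; apply: good_quad => //.
- by apply: (gd (s, t)); split => /=; lra.
- by apply: (gd (s + r / 2, t)); split => /=; lra.
- by apply: (gd (s, t + r / 2)); split => /=; lra.
- by apply: (gd (s + r / 2, t + r / 2)); split => /=; lra.
Qed.

Let nested_bound (x : nat -> R) (r : nat -> R) :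
  (forall n, 0 < r n) -> (forall n, x n <= x n.+1) ->
  (forall n, x n.+1 + r n.+1 <= x n + r n) ->
  exists l, forall n, x n <= l <= x n + r n.
Proof.
move=> r0 xi xd.
have xle n m : x n <= x (n + m)%N.
  by elim: m => [|m IH]; rewrite ?addn0 // addnS (le_trans IH).
have xge n m : x (n + m)%N + r (n + m)%N <= x n + r n.
  by elim: m => [|m IH]; rewrite ?addn0 // addnS (le_trans (xd _)).
have ub n : ubound (range x) (x n + r n).
  move=> _ [m _ <-]; have := xle m n; have := xge n m.
  by rewrite addnC => h1 h2; have := r0 (m + n)%N; lra.
have hs : has_sup (range x) by split; [exists (x 0%N); exists 0%N | exists (x 0%N + r 0%N)].
exists (sup (range x)) => n; apply/andP; split.
  by apply: ub_le_sup; [exact: hs.2 | exists n].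
by apply: ge_sup; [exact: hs.1 | exact: ub].
Qed.

(** Every bad square has a bad quarter. The corners of the resulting nested squares converge to a
    point (x, y) lying in all of them, and [good_local] at (x, y) contradicts the badness of the
    small ones. *)
Lemma bisection : good 0 0 1.
Proof.
apply: contrapT => bad.
pose r (n : nat) : R := 2^-1 ^+ n.
have r0 n : 0 < r n by rewrite exprn_gt0 // invr_gt0.
have rS n : r n.+1 = r n / 2 by rewrite /r exprSr.
pose ok (n : nat) (a : R * R) := in_unit a (r n) /\ ~ good a.1 a.2 (r n).
have step n a : {b | ok n a -> sub_square a b (r n) /\ ok n.+1 b}.
  apply: cid; have [[ia ba]|nok] := pselect (ok n a); last by exists a.
  have [b [sb nb]] := bad_child (r0 n) ia ba.
  exists b => _; split=> //; split; last by rewrite rS.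
  by case: sb ia => ? ? ? ? [? ? ? ?]; split; rewrite ?rS; lra.
pose a := fix a n := if n is m.+1 then sval (step m (a m)) else (0, 0).
have aok n : ok n (a n).
  elim: n => [|n IH] /=; first by split => //; split => /=; rewrite ?/r ?expr0; lra.
  by case: (step n (a n)) => b /= /(_ IH) [].
have asub n : sub_square (a n) (a n.+1) (r n).
  by rewrite /=; case: (step n (a n)) => b /= /(_ (aok n)) [].
have [x hx] : exists l, forall n, (a n).1 <= l <= (a n).1 + r n.
  by apply: (nested_bound r0) => n; case: (asub n); rewrite ?rS.
have [y hy] : exists l, forall n, (a n).2 <= l <= (a n).2 + r n.
  by apply: (nested_bound r0) => n; case: (asub n); rewrite ?rS.
have x01 : 0 <= x <= 1 by have := hx 0%N; rewrite /= /r expr0 add0r.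
have y01 : 0 <= y <= 1 by have := hy 0%N; rewrite /= /r expr0 add0r.
have [d d0 hd] := good_local x01 y01.
have [n rn] : exists n, r n < d.
  have : (r n @[n --> \oo] --> (0 : R)).
    by apply: cvg_expr; rewrite ger0_norm; lra.
  move/cvgrPdist_lt => /(_ d d0) [n _ /(_ n (leqnn n))].
  by rewrite /= sub0r normrN ger0_norm ?(ltW (r0 n)) // => ?; exists n.
have [[s0 _ t0 _]] := aok n; apply.
by apply: hd => //; rewrite r0.
Qed.

End Bisection.

(** * Trapezoidal sums in place of contour integrals *)

(* The factor 1/2 of the trapezoidal rule is dropped: [trapezoid g k A B]
   approximates twice the integral of [g] over the segment from A to B, cut
   into 2 ^ k pieces. *)
Fixpoint trapezoid (R : realType) (g : cplx R -> cplx R) (k : nat)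
    (A B : cplx R) : cplx R :=
  if k is m.+1 then
    trapezoid g m A ((A + B) / 2) + trapezoid g m ((A + B) / 2) B
  else (B - A) * (g A + g B).

Definition boundary_sum (R : realType) (g : cplx R -> cplx R) (k : nat)
    (A u v : cplx R) : cplx R :=
  trapezoid g k A (A + u) + trapezoid g k (A + u) (A + u + v) +
  trapezoid g k (A + u + v) (A + v) + trapezoid g k (A + v) A.

Definition complex_diff (R : realType) (g : cplx R -> cplx R) (w : cplx R) :=
  exists L : cplx R, forall e : R, 0 < e -> exists2 d : R, 0 < d &
    forall z, modulus (z - w) < d ->
      modulus (g z - g w - L * (z - w)) <= e * modulus (z - w).

Section Trapezoid.
Variable R : realType.
Local Notation C := (cplx R).
Local Notation md := (@modulus R).
Implicit Types (A B z w : C) (g h : C -> C).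

Lemma modulus_nat n : md n%:R = n%:R.
Proof. by apply: (@complexI R); rewrite -normE normr_nat rmorph_nat. Qed.

Lemma modulus_half z : md (z / 2) = md z / 2.
Proof. by rewrite modulusM modulusV modulus_nat. Qed.

Let seg_left A B (t : R) :
  A + t%:C%C * ((A + B) / 2 - A) = A + (t / 2)%:C%C * (B - A).
Proof. by rewrite of_realM of_real_half; field. Qed.

Let seg_right A B (t : R) :
  (A + B) / 2 + t%:C%C * (B - (A + B) / 2) =
  A + (2^-1 + t / 2)%:C%C * (B - A).
Proof. by rewrite of_realD of_realM of_real_half; field. Qed.

Lemma trapezoid_bound g k A B M :
  (forall t : R, 0 <= t <= 1 -> md (g (A + t%:C%C * (B - A))) <= M) ->
  md (trapezoid g k A B) <= 2 * M * md (B - A).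
Proof.
elim: k A B => [|k IH] A B hM.
  have h0 := hM 0; have h1 := hM 1.
  rewrite mul0r addr0 lexx ler01 in h0; rewrite mul1r subrKC lexx ler01 in h1.
  rewrite /= modulusM mulrC ler_wpM2r ?modulus_ge0 //.
  apply: (le_trans (modulusD _ _)).
  by rewrite mulr2n mulrDl mul1r lerD ?h0 ?h1.
have hl : md ((A + B) / 2 - A) = md (B - A) / 2.
  by rewrite -modulus_half; congr md; field.
have hr : md (B - (A + B) / 2) = md (B - A) / 2.
  by rewrite -modulus_half; congr md; field.
rewrite /=; apply: (le_trans (modulusD _ _)).
have -> : 2 * M * md (B - A) = 2 * M * (md (B - A) / 2) + 2 * M * (md (B - A) / 2).
  by field.
apply: lerD; [rewrite -hl | rewrite -[X in _ <= _ * X]hr]; apply: IH => t t01.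
  by rewrite seg_left hM //; lra.
by rewrite seg_right hM //; lra.
Qed.

Lemma eq_trapezoid g h k A B :
  (forall t : R, 0 <= t <= 1 ->
    g (A + t%:C%C * (B - A)) = h (A + t%:C%C * (B - A))) ->
  trapezoid g k A B = trapezoid h k A B.
Proof.
elim: k A B => [|k IH] A B gh.
  have h0 := gh 0; have h1 := gh 1.
  rewrite mul0r addr0 lexx ler01 in h0; rewrite mul1r subrKC lexx ler01 in h1.
  by rewrite /= h0 // h1.
rewrite /= !IH // => t t01; rewrite ?seg_left ?seg_right gh //; lra.
Qed.

Lemma trapezoidD g h k A B : trapezoid (fun z => g z + h z) k A B =
  trapezoid g k A B + trapezoid h k A B.
Proof. by elim: k A B => [|k IH] A B /=; rewrite ?IH; ring. Qed.

Lemma trapezoidZ c g k A B : trapezoid (fun z => c * g z) k A B =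
  c * trapezoid g k A B.
Proof. by elim: k A B => [|k IH] A B /=; rewrite ?IH; ring. Qed.

(** The trapezoidal rule is exact on affine functions at every level: the right side is twice the
    increment of the primitive a z + b z^2 / 2. *)
Lemma trapezoid_affine a b k A B : trapezoid (fun z => a + b * z) k A B =
  2 * a * (B - A) + b * (B ^+ 2 - A ^+ 2).
Proof. by elim: k A B => [|k IH] A B /=; rewrite ?IH; field. Qed.

Lemma trapezoid_rev g k A B : trapezoid g k B A = - trapezoid g k A B.
Proof.
elim: k A B => [|k IH] A B /=; [by ring|].
by rewrite (addrC B A) (IH A ((A + B) / 2)) (IH ((A + B) / 2) B) opprD addrC.
Qed.

(** Each inner edge of the four quarters is run through twice in opposite directions and cancels.
    Halving the outer edges uses up one level of subdivision, hence [k.+1] against [k]. *)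
Lemma boundary_sum_quad g k A u v : boundary_sum g k.+1 A u v =
  boundary_sum g k A (u / 2) (v / 2) +
  boundary_sum g k (A + u / 2) (u / 2) (v / 2) +
  boundary_sum g k (A + v / 2) (u / 2) (v / 2) +
  boundary_sum g k (A + u / 2 + v / 2) (u / 2) (v / 2).
Proof.
rewrite /boundary_sum /=.
have -> : (A + (A + u)) / 2 = A + u / 2 by field.
have -> : (A + u + (A + u + v)) / 2 = A + u + v / 2 by field.
have -> : (A + u + v + (A + v)) / 2 = A + u / 2 + v by field.
have -> : (A + v + A) / 2 = A + v / 2 by field.
have -> : A + u / 2 + u / 2 = A + u by field.
have -> : A + v / 2 + v / 2 = A + v by field.
have -> : A + v / 2 + u / 2 = A + u / 2 + v / 2 by ring.
have -> : A + u / 2 + v / 2 + v / 2 = A + u / 2 + v by field.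
have -> : A + u / 2 + v / 2 + u / 2 = A + u + v / 2 by field.
have -> : A + u + v / 2 + v / 2 = A + u + v by field.
rewrite (trapezoid_rev g k (A + u / 2 + v / 2) (A + u / 2)).
rewrite (trapezoid_rev g k (A + u / 2 + v / 2) (A + v / 2)).
rewrite (trapezoid_rev g k (A + u / 2 + v / 2) (A + u + v / 2)).
rewrite (trapezoid_rev g k (A + u / 2 + v / 2) (A + u / 2 + v)).
by ring.
Qed.

Lemma boundary_sum_bound g k A u v M :
  (forall s t : R, 0 <= s <= 1 -> 0 <= t <= 1 ->
    md (g (A + s%:C%C * u + t%:C%C * v)) <= M) ->
  md (boundary_sum g k A u v) <= 4 * M * (md u + md v).
Proof.
move=> hM; rewrite /boundary_sum.
have e1 : md (trapezoid g k A (A + u)) <= 2 * M * md u.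
  rewrite -[in X in _ <= X](addKr A u) (addrC (- A)).
  apply: trapezoid_bound => t t01; have := hM t 0 t01.
  by rewrite mul0r addr0 addrAC subrr add0r; apply; rewrite lexx ler01.
have e2 : md (trapezoid g k (A + u) (A + u + v)) <= 2 * M * md v.
  have E : A + u + v - (A + u) = v by ring.
  rewrite -[in X in _ <= X]E; apply: trapezoid_bound => t t01; rewrite E.
  by have := hM 1 t; rewrite mul1r; apply; rewrite ?lexx ?ler01.
have e3 : md (trapezoid g k (A + u + v) (A + v)) <= 2 * M * md u.
  have E : A + v - (A + u + v) = - u by ring.
  rewrite -[in X in _ <= X]modulusN -[in X in _ <= X]E.
  apply: trapezoid_bound => t t01; rewrite E.
  have -> : A + u + v + t%:C%C * - u = A + (1 - t)%:C%C * u + 1%:C%C * v.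
    by rewrite of_realB; ring.
  by apply: hM; lra.
have e4 : md (trapezoid g k (A + v) A) <= 2 * M * md v.
  have E : A - (A + v) = - v by ring.
  rewrite -[in X in _ <= X]modulusN -[in X in _ <= X]E.
  apply: trapezoid_bound => t t01; rewrite E.
  have -> : A + v + t%:C%C * - v = A + 0%:C%C * u + (1 - t)%:C%C * v.
    by rewrite of_realB; ring.
  by apply: hM; lra.
have := modulusD (trapezoid g k A (A + u)) (trapezoid g k (A + u) (A + u + v)).
have := modulusD (trapezoid g k A (A + u) + trapezoid g k (A + u) (A + u + v))
  (trapezoid g k (A + u + v) (A + v)).
have := modulusD (trapezoid g k A (A + u) + trapezoid g k (A + u) (A + u + v) +
  trapezoid g k (A + u + v) (A + v)) (trapezoid g k (A + v) A).
by lra.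
Qed.

(** Affine functions are integrated exactly and have a primitive, so they contribute 0 around a
    closed polygon. *)
Lemma boundary_sum_diff g k A u v L w : boundary_sum g k A u v =
  boundary_sum (fun z => g z - g w - L * (z - w)) k A u v.
Proof.
pose h z := g z - g w - L * (z - w).
have E k' A' B' : trapezoid g k' A' B' = trapezoid h k' A' B' +
    trapezoid (fun z => (g w - L * w) + L * z) k' A' B'.
  by rewrite -trapezoidD; apply: eq_trapezoid => t _; rewrite /h; ring.
by rewrite /boundary_sum !E !trapezoid_affine -/h; ring.
Qed.

End Trapezoid.

(** * Goursat's argument with one exceptional corner *)

Section Goursat.
Variable R : realType.
Local Notation C := (cplx R).
Local Notation md := (@modulus R).

(* In the bisection, the exceptional corner is charged to the unique square
   that contains it at each scale, by adding a unit point mass to the area. *)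
Lemma goursat (g : C -> C) (A u v : C) :
  (forall s t : R, 0 <= s <= 1 -> 0 <= t <= 1 -> (s != 0) || (t != 0) ->
    complex_diff g (A + s%:C%C * u + t%:C%C * v)) ->
  (exists M d : R, 0 < d /\ forall z, md (z - A) < d -> md (g z) <= M) ->
  forall e : R, 0 < e ->
    exists K, forall k, (K <= k)%N -> md (boundary_sum g k A u v) <= e.
Proof.
move=> gd [M [d0 [d00 gM]]] e e0.
(* The summand 1 keeps [D] positive even when u = v = 0. *)
pose D := md u + md v + 1.
have D1 : 1 <= D by rewrite lerDr addr_ge0 ?modulus_ge0.
have D0 : 0 < D by lra.
have uD : md u + md v <= D by rewrite lerDl ler01.
have uv0 : 0 <= md u + md v by rewrite addr_ge0 ?modulus_ge0.
pose mass (s t r : R) : R := r ^+ 2 + ((s == 0) && (t == 0))%:R.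
pose sq (s t r : R) k := boundary_sum g k (A + s%:C%C * u + t%:C%C * v)
  (r%:C%C * u) (r%:C%C * v).
pose good s t r := exists K, forall k, (K <= k)%N ->
  md (sq s t r k) <= e / 2 * mass s t r.
have mdr (r : R) (z : C) : 0 <= r -> md (r%:C%C * z) = r * md z.
  by move=> r0; rewrite modulusM modulus_real ger0_norm.
(* The whole square has mass 1 + 1, so e / 2 times its mass is e. *)
suff [K hK] : good 0 0 1.
  exists K => k /hK; rewrite /sq /mass !mul0r !addr0 !mul1r expr1n !eqxx /=.
  by lra.
apply: bisection => [s t r r0 s0 s1 t0 t1 [K1 h1] [K2 h2] [K3 h3] [K4 h4]|x y x01 y01].
  exists (K1 + K2 + K3 + K4).+1%N => -[//|k]; rewrite ltnS => Kk.
  have := h1 k (leq_trans (leq_trans (leq_addr _ _) (leq_trans (leq_addr _ _) (leq_addr _ _))) Kk).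
  have := h2 k (leq_trans (leq_trans (leq_addl _ _) (leq_trans (leq_addr _ _) (leq_addr _ _))) Kk).
  have := h3 k (leq_trans (leq_trans (leq_addl _ _) (leq_addr _ _)) Kk).
  have := h4 k (leq_trans (leq_addl _ _) Kk).
  have -> : sq s t r k.+1 = sq s t (r / 2) k + sq (s + r / 2) t (r / 2) k +
      sq s (t + r / 2) (r / 2) k + sq (s + r / 2) (t + r / 2) (r / 2) k.
    rewrite /sq boundary_sum_quad !of_realD of_realM of_real_half.
    by congr (_ + _ + _ + _); congr (boundary_sum _ _ _ _ _); ring.
  rewrite /mass.
  (* Only the quarter with corner (s, t) can carry the point mass, so the masses of the four
     quarters add up to that of the square. *)
  have -> : (s + r / 2 == 0) = false by apply/eqP; lra.
  have -> : (t + r / 2 == 0) = false by apply/eqP; lra.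
  rewrite /= !andbF !addr0.
  set b := (_ && _)%:R : R.
  set z1 := sq s t _ k; set z2 := sq _ t _ k; set z3 := sq s (_ + _) _ k.
  set z4 := sq _ _ _ k.
  have := modulusD (z1 + z2 + z3) z4; have := modulusD (z1 + z2) z3.
  have := modulusD z1 z2.
  have -> : (r / 2) ^+ 2 = r ^+ 2 / 4 by field.
  by lra.
have small s t r p (r0 : 0 < r) (M0 : R) :
    (forall s' t' : R, 0 <= s' <= 1 -> 0 <= t' <= 1 ->
      md (p (A + (s + s' * r)%:C%C * u + (t + t' * r)%:C%C * v)) <= M0) ->
    forall k, md (boundary_sum p k (A + s%:C%C * u + t%:C%C * v)
      (r%:C%C * u) (r%:C%C * v)) <= 4 * M0 * (r * (md u + md v)).
  move=> pM k; rewrite mulrDr -!mdr ?(ltW r0) //.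
  apply: boundary_sum_bound => s' t' hs ht.
  have := pM s' t' hs ht; rewrite !of_realD !of_realM; congr (md (p _) <= _); ring.
have near s t r x' y' s' t' : 0 < r -> s <= x' <= s + r -> t <= y' <= t + r ->
    0 <= s' <= 1 -> 0 <= t' <= 1 ->
    md (A + (s + s' * r)%:C%C * u + (t + t' * r)%:C%C * v -
      (A + x'%:C%C * u + y'%:C%C * v)) <= r * D.
  move=> r0 hx hy hs ht.
  have -> : A + (s + s' * r)%:C%C * u + (t + t' * r)%:C%C * v -
      (A + x'%:C%C * u + y'%:C%C * v) =
      (s + s' * r - x')%:C%C * u + (t + t' * r - y')%:C%C * v.
    by rewrite !of_realB; ring.
  apply: (le_trans (modulusD _ _)); rewrite !modulusM !modulus_real.
  apply: (@le_trans _ _ (r * md u + r * md v)).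
    by apply: lerD; apply: ler_wpM2r; rewrite ?modulus_ge0 // ler_norml; nra.
  by rewrite -mulrDr ler_wpM2l // ltW.
have [xy|xy] := boolP ((x != 0) || (y != 0)).
  have [L hL] := gd x y x01 y01 xy.
  (* Chosen so that 4 * (e' * (r * D)) * (r * D) is e / 2 times the area r^2. *)
  pose e' := e / (8 * D ^+ 2).
  have e'0 : 0 < e' by rewrite divr_gt0 // mulr_gt0 // exprn_gt0.
  have [d dp hd] := hL _ e'0.
  exists (d / D) => [|s t r /andP[r0 rd] s0 t0 hx hy]; first by rewrite divr_gt0.
  exists 0%N => k _; rewrite /sq (boundary_sum_diff _ _ _ _ _ L (A + x%:C%C * u + y%:C%C * v)).
  have rD : r * D < d by rewrite -ltr_pdivlMr.
  apply: (@le_trans _ _ (4 * (e' * (r * D)) * (r * (md u + md v)))).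
    apply: (small s t r (fun z => g z - g (A + x%:C%C * u + y%:C%C * v) -
      L * (z - (A + x%:C%C * u + y%:C%C * v)))) => // s' t' hs ht.
    have nr := near s t r x y s' t' r0 hx hy hs ht.
    apply: (le_trans (hd _ _)); first by apply: le_lt_trans nr _.
    by rewrite ler_wpM2l // ltW.
  apply: (@le_trans _ _ (4 * (e' * (r * D)) * (r * D))).
    apply: ler_wpM2l; last by apply: ler_wpM2l => //; exact: ltW.
    by rewrite !(ltW e'0, mulr_ge0, ler0n, ltW r0, ltW D0).
  have -> : 4 * (e' * (r * D)) * (r * D) = e / 2 * r ^+ 2.
    by rewrite /e'; field; lra.
  by rewrite ler_wpM2l // /mass ?lerDl // divr_ge0 // ltW.
move: xy; rewrite negb_or !negbK => /andP[/eqP x0 /eqP y0].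
pose M1 := 1 + `|M|.
have M10 : 0 < M1 by rewrite ltr_pwDl.
(* At the exceptional corner g is only bounded. The first bound keeps the square where |g| <= M; the
   second makes the sum, at most 4 * M1 * r * D, smaller than e / 2, which the point mass pays
   for. *)
pose d1 := Num.min (d0 / D) (e / (8 * M1 * D)).
exists d1 => [|s t r /andP[r0 rd] s0 t0 hx hy].
  by rewrite lt_min !divr_gt0 // !mulr_gt0.
have [E1 E2] : s = 0 /\ t = 0 by split; lra.
subst s t; exists 0%N => k _; rewrite /sq.
move: rd; rewrite lt_min => /andP[rd1 rd2].
apply: (@le_trans _ _ (4 * M1 * (r * (md u + md v)))).
  apply: (small 0 0 r g) => // s' t' hs ht.
  have nr := near 0 0 r 0 0 s' t' r0.
  have : md (g (A + (0 + s' * r)%:C%C * u + (0 + t' * r)%:C%C * v)) <= M.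
    apply: gM; rewrite [X in _ - X](_ : A = A + 0%:C%C * u + 0%:C%C * v).
      apply: (le_lt_trans (nr _ _ hs ht)); rewrite ?lexx ?add0r ?ltW //=.
      by rewrite -ltr_pdivlMr.
    by rewrite !mul0r !addr0.
  by move=> h; apply: (le_trans h); rewrite /M1 (le_trans (ler_norm _)) // lerDr.
apply: (@le_trans _ _ (4 * M1 * (r * D))).
  apply: ler_wpM2l; last by apply: ler_wpM2l => //; exact: ltW.
  by rewrite !(ltW M10, mulr_ge0, ler0n, ltW r0, ltW D0).
rewrite /mass !eqxx /=.
have : r * (8 * M1 * D) < e by rewrite -ltr_pdivlMr // !mulr_gt0.
have : 0 <= e * r ^+ 2 by rewrite mulr_ge0 ?sqr_ge0 // ltW.
by lra.
Qed.

End Goursat.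

(** * Neighbourhoods and complex derivatives in terms of the modulus *)

Section ComplexDerivative.
Variable R : realType.
Local Notation C := (cplx R).
Local Notation md := (@modulus R).

Lemma norm_lt_modulus (z : C) (e : C) : 0 < e -> (`|z| < e) = (md z < complex.Re e).
Proof.
move=> e0; have eE : e = (complex.Re e)%:C%C.
  by move: e0; case: e => a b; rewrite ltcE /= => /andP[/eqP -> _].
by rewrite normE [in LHS]eE ltcR.
Qed.

Lemma Re_gt0 (e : C) : 0 < e -> 0 < complex.Re e.
Proof. by case: e => a b; rewrite ltcE /= => /andP[_ ->]. Qed.

Lemma nbhs_modulusP (p : C) (P : set C) :
  nbhs p P <-> exists2 d : R, 0 < d & forall z, md (z - p) < d -> P z.
Proof.
split.
  move/nbhs_ballP => [d /= d0 dP]; exists (complex.Re d); first exact: Re_gt0.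
  by move=> z zd; apply: dP; rewrite -ball_normE /= norm_lt_modulus // modulusB.
move=> [d d0 dP]; apply/nbhs_ballP; exists d%:C%C; first by rewrite /= ltcR.
move=> z; rewrite -ball_normE /= norm_lt_modulus ?ltcR //= modulusB; exact: dP.
Qed.

Lemma derivable_complex_diff (g : C -> C) w : derivable g w 1 -> complex_diff g w.
Proof.
move=> /cvg_ex [L /cvgrPdist_lt hL]; exists L => e e0.
have /hL : 0 < (e%:C%C : C) by rewrite ltcR.
rewrite near_withinE near_simpl => /nbhs_modulusP [d d0 hd].
exists d => // z zd.
have [->|zw] := eqVneq z w; first by rewrite !subrr mulr0 subr0 modulus0 mulr0.
have zw0 : z - w != 0 by rewrite subr_eq0.
have := hd (z - w); rewrite subr0 => /(_ zd zw0).
rewrite norm_lt_modulus ?ltcR //= => /ltW h.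
have -> : g z - g w - L * (z - w) =
    - ((L - (z - w)^-1 *: (g ((z - w) *: 1 + w) - g w)) * (z - w)).
  have -> : (z - w) *: (1 : C) + w = z by rewrite /GRing.scale /= mulr1 subrK.
  by rewrite /GRing.scale /=; field.
by rewrite modulusN modulusM ler_wpM2r ?modulus_ge0.
Qed.

End ComplexDerivative.

(** * A Cauchy estimate on the rectangle [-2, 2] x [-1, 1] *)

Definition cpoint (R : realType) (x y : R) : cplx R := (x +i* y)%C.

Section CauchyBound.
Variable R : realType.
Local Notation C := (cplx R).
Local Notation md := (@modulus R).
Local Notation pt := (@cpoint R).
Implicit Types (A B z w : C) (g h : C -> C).

Lemma Re_segment A B (t : R) : complex.Re (A + t%:C%C * (B - A)) =
  complex.Re A + t * (complex.Re B - complex.Re A).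
Proof. by case: A => a a'; case: B => b b' /=; ring. Qed.

Lemma Im_segment A B (t : R) : complex.Im (A + t%:C%C * (B - A)) =
  complex.Im A + t * (complex.Im B - complex.Im A).
Proof. by case: A => a a'; case: B => b b' /=; ring. Qed.

Lemma ImD z w : complex.Im (z + w) = complex.Im z + complex.Im w.
Proof. by case: z; case: w. Qed.

(** This is Im (conj z * w), the oriented area spanned by z and w. *)
Definition cross z w := complex.Re z * complex.Im w - complex.Im z * complex.Re w.

Lemma Im_div z w : complex.Im (w / z) = cross z w / md z ^+ 2.
Proof. by rewrite modulus_sqr /cross; case: z => a b; case: w => c d /=; ring. Qed.

(** The number [cross P (B - A)] is the same for all points P of the segment, and Im ((B - A) / P)
    is this number divided by |P|^2. Each bisection halves it on both pieces, so the bound is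
    additive. This replaces the computation of a winding number around 0. *)
Lemma Im_trapezoid_inv k A B (m : R) :
  0 <= cross A (B - A) ->
  (forall t : R, 0 <= t <= 1 -> 0 < md (A + t%:C%C * (B - A)) ^+ 2 <= m) ->
  2 * cross A (B - A) / m <= complex.Im (trapezoid (fun w => w^-1) k A B).
Proof.
have step (x y : R) : 0 <= x -> 0 < y <= m -> x / m <= x / y.
  move=> x0 /andP[y0 ym]; apply: ler_wpM2l => //.
  by rewrite lef_pV2 // posrE // (lt_le_trans y0).
elim: k A B => [|k IH] A B c0 hm.
  have h0 := hm 0; have h1 := hm 1.
  rewrite mul0r addr0 lexx ler01 in h0; rewrite mul1r subrKC lexx ler01 in h1.
  have -> : complex.Im (trapezoid (fun w => w^-1) 0 A B) =
      cross A (B - A) / md A ^+ 2 + cross B (B - A) / md B ^+ 2.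
    by rewrite -!Im_div -ImD -mulrDr.
  have -> : cross B (B - A) = cross A (B - A).
    by rewrite /cross; case: A {c0 hm h0 h1} => ? ?; case: B => ? ? /=; ring.
  rewrite -mulrA mulr2n mulrDl mul1r.
  by apply: lerD; apply: step; rewrite ?h0 ?h1.
set D := (A + B) / 2.
have DE : D = A + (2^-1)%:C%C * (B - A) by rewrite fmorphV rmorph_nat /D; field.
have D1 : D - A = (2^-1)%:C%C * (B - A) by rewrite DE; ring.
have D2 : B - D = (2^-1)%:C%C * (B - A).
  by rewrite fmorphV rmorph_nat /D; field.
have c1 : cross A (D - A) = cross A (B - A) / 2.
  rewrite D1 /cross; case: A {c0 hm D DE D1 D2} => ? ?; case: B => ? ? /=.
  by ring.
have c2 : cross D (B - D) = cross A (B - A) / 2.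
  rewrite D2 DE /cross; case: A {c0 hm D DE D1 D2 c1} => ? ?; case: B => ? ? /=.
  by ring.
have E (s : R) : ((s / 2)%:C%C : C) = s%:C%C * (2^-1)%:C%C by rewrite rmorphM.
rewrite -[trapezoid _ k.+1 A B]/(trapezoid _ k A D + trapezoid _ k D B) [X in _ <= X]ImD.
have := IH A D; have := IH D B; rewrite c1 c2 => h2 h1.
have -> : 2 * cross A (B - A) / m = 2 * (cross A (B - A) / 2) / m +
    2 * (cross A (B - A) / 2) / m by field; apply/eqP => m0;
    have := hm 0; rewrite lexx ler01 m0 => /(_ isT); lra.
apply: lerD; [apply: h1 | apply: h2]; rewrite ?divr_ge0 // => t t01.
  by rewrite D1 mulrA -E; apply: hm; lra.
rewrite D2 mulrA -E.
have -> : D + (t / 2)%:C%C * (B - A) = A + (2^-1 + t / 2)%:C%C * (B - A).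
  by rewrite DE rmorphD; ring.
by apply: hm; lra.
Qed.

Definition rect_boundary w := [/\ `|complex.Re w| <= 2, `|complex.Im w| <= 1 &
  (`|complex.Re w| == 2) || (`|complex.Im w| == 1)].

(** The sides are also cut at their midpoints, so that these are the outer edges of four rectangles
    meeting at 0, and every edge A B has [cross A (B - A)] equal to 2. *)
Definition rect_sum g k :=
  trapezoid g k (pt 2 0) (pt 2 1) + trapezoid g k (pt 2 1) (pt 0 1) +
  trapezoid g k (pt 0 1) (pt (-2) 1) + trapezoid g k (pt (-2) 1) (pt (-2) 0) +
  trapezoid g k (pt (-2) 0) (pt (-2) (-1)) +
  trapezoid g k (pt (-2) (-1)) (pt 0 (-1)) +
  trapezoid g k (pt 0 (-1)) (pt 2 (-1)) + trapezoid g k (pt 2 (-1)) (pt 2 0).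

(** The edges issuing from 0 cancel in pairs. The point 0 is thus a corner of each rectangle, the
    position [goursat] allows for the exceptional point. *)
Lemma rect_sum_quad g k : rect_sum g k =
  boundary_sum g k 0 (pt 2 0) (pt 0 1) +
  boundary_sum g k 0 (pt 0 1) (pt (-2) 0) +
  boundary_sum g k 0 (pt (-2) 0) (pt 0 (-1)) +
  boundary_sum g k 0 (pt 0 (-1)) (pt 2 0).
Proof.
have ptD a b c d : pt a b + pt c d = pt (a + c) (b + d) by [].
rewrite /boundary_sum !add0r !ptD !addr0 !add0r /rect_sum.
rewrite (trapezoid_rev g k 0 (pt 2 0)) (trapezoid_rev g k 0 (pt 0 1)).
rewrite (trapezoid_rev g k 0 (pt (-2) 0)) (trapezoid_rev g k 0 (pt 0 (-1))).
by ring.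
Qed.

Definition rect_edge A B := [/\ cross A (B - A) = 2, md (B - A) <= 2 &
  forall t : R, 0 <= t <= 1 -> rect_boundary (A + t%:C%C * (B - A))].

Lemma rect_edgeP a b c d : a * (d - b) - b * (c - a) = 2 ->
  `|c - a| + `|d - b| <= 2 ->
  (forall t : R, 0 <= t <= 1 -> [/\ `|a + t * (c - a)| <= 2,
     `|b + t * (d - b)| <= 1 &
     (`|a + t * (c - a)| == 2) || (`|b + t * (d - b)| == 1)]) ->
  rect_edge (pt a b) (pt c d).
Proof.
move=> h1 h2 h3; split => //.
  by apply: le_trans (modulus_le_ReIm _) _.
by move=> t t01; rewrite /rect_boundary Re_segment Im_segment; apply: h3.
Qed.

Lemma rect_edges :
  [/\ rect_edge (pt 2 0) (pt 2 1), rect_edge (pt 2 1) (pt 0 1),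
      rect_edge (pt 0 1) (pt (-2) 1) & rect_edge (pt (-2) 1) (pt (-2) 0)] /\
  [/\ rect_edge (pt (-2) 0) (pt (-2) (-1)),
      rect_edge (pt (-2) (-1)) (pt 0 (-1)),
      rect_edge (pt 0 (-1)) (pt 2 (-1)) & rect_edge (pt 2 (-1)) (pt 2 0)].
Proof.
have abs (x m : R) : -m <= x <= m -> `|x| <= m by rewrite ler_norml.
have ap (x : R) : x = 2 \/ x = -2 -> (`|x| == 2).
  by case=> ->; rewrite ?normrN ger0_norm.
have aq (x : R) : x = 1 \/ x = -1 -> (`|x| == 1).
  by case=> ->; rewrite ?normrN ger0_norm.
have sm (x y : R) : (x = 0 /\ -2 <= y <= 2) \/ (y = 0 /\ -2 <= x <= 2) -> `|x| + `|y| <= 2.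
  by case=> -[-> /abs]; rewrite normr0 ?add0r ?addr0.
split; split; apply: rect_edgeP; try (by lra);
  try (by apply: sm; lra);
  (move=> t t01; split; [apply: abs; lra | apply: abs; lra |]);
  first [rewrite ap //; lra | rewrite orbC aq //; lra].
Qed.

Lemma rect_boundary_modulus w : rect_boundary w -> 1 <= md w /\ md w ^+ 2 <= 5.
Proof.
move=> [h1 h2 h3]; split.
  case/orP: h3 => /eqP h.
    by apply: le_trans (Re_le_modulus w); rewrite h ler1n.
  by apply: le_trans (Im_le_modulus w); rewrite h.
rewrite modulus_sqr -[_ ^+ 2]real_normK ?num_real // -[X in _ + X]real_normK ?num_real //.
have := normr_ge0 (complex.Re w); have := normr_ge0 (complex.Im w); nra.
Qed.

(** By [goursat] the sums of [H] tend to 0, so g(0) times the sum of 1 / w is nearly the sum of g(w)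
    / w. The former sum has modulus at least 32 / 5, the latter at most 32 * M. *)
Lemma rect_cauchy_bound g (M : R) :
  (forall w, `|complex.Re w| <= 2 -> `|complex.Im w| <= 1 -> derivable g w 1) ->
  (forall w, rect_boundary w -> md (g w) <= M) ->
  md (g 0) <= 5 * M.
Proof.
move=> gd gM.
pose H w := (g w - g 0) * w^-1.
have Hd w : `|complex.Re w| <= 2 -> `|complex.Im w| <= 1 -> w != 0 -> derivable H w 1.
  move=> w1 w2 w0; apply: (@derivableM _ _ (g - cst (g 0)) (fun w => w^-1)).
    by apply: derivableB; [exact: gd | exact: derivable_cst].
  by apply: (derivableV (f := id)) => //; exact: derivable_id.
have Hb : exists N d : R, 0 < d /\ forall z, md (z - 0) < d -> md (H z) <= N.
  have [|L hL] := @derivable_complex_diff _ g 0.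
    by apply: gd; rewrite /= normr0.
  have [d d0 hd] := hL 1 ltr01; exists (md L + 1), d; split=> // z.
  rewrite subr0 => zd; have [->|z0] := eqVneq z 0.
    by rewrite /H subrr mul0r modulus0 addr_ge0 ?modulus_ge0.
  rewrite /H modulusM modulusV ler_pdivrMr ?modulus_gt0 // mulrDl.
  have := hd z; rewrite subr0 mul1r => /(_ zd) h.
  have -> : g z - g 0 = L * z + (g z - g 0 - L * z) by ring.
  by apply: le_trans (modulusD _ _) _; rewrite modulusM lerD2l.
(* The nonzero determinant makes s = t = 0 the only parameters at which the singularity 0 of [H] is
   met. *)
have Hsmall a b c d e : 0 < e -> (a * d != b * c) ->
   (`|a| <= 2 /\ c = 0 \/ a = 0 /\ `|c| <= 2) -> (`|b| <= 1 /\ d = 0 \/ b = 0 /\ `|d| <= 1) ->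
    exists K, forall k, (K <= k)%N -> md (boundary_sum H k 0 (pt a b) (pt c d)) <= e.
  move=> e0 det hac hbd; apply: goursat => // s t s01 t01 st.
  have E : 0 + s%:C%C * pt a b + t%:C%C * pt c d = pt (s * a + t * c) (s * b + t * d).
    by congr Complex => /=; ring.
  have nm (x y m : R) : 0 <= x <= 1 -> `|y| <= m -> `|x * y| <= m.
    move=> x01 ym; rewrite normrM ger0_norm; last by lra.
    by have := normr_ge0 y; nra.
  apply: derivable_complex_diff; rewrite E; apply: Hd => /=.
  - by case: hac => -[h1 h2]; rewrite ?h1 ?h2 mulr0 ?addr0 ?add0r nm.
  - by case: hbd => -[h1 h2]; rewrite ?h1 ?h2 mulr0 ?addr0 ?add0r nm.
  apply/eqP => -[] E1 E2; move/negP: det; apply.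
  have Es : s * (a * d - b * c) = 0.
    by have -> : s * (a * d - b * c) = (s * a + t * c) * d - (s * b + t * d) * c
      by [ring]; rewrite E1 E2; ring.
  have Et : t * (a * d - b * c) = 0.
    by have -> : t * (a * d - b * c) = (s * b + t * d) * a - (s * a + t * c) * b
      by [ring]; rewrite E1 E2; ring.
  case/orP: st => n0.
    by move/eqP: Es; rewrite mulf_eq0 (negPf n0) subr_eq0.
  by move/eqP: Et; rewrite mulf_eq0 (negPf n0) subr_eq0.
have sumle (f : C -> C) (N : R) k :
    (forall A B, rect_edge A B -> md (trapezoid f k A B) <= N) ->
    md (rect_sum f k) <= 8 * N.
  move=> hN; have [[E1 E2 E3 E4] [E5 E6 E7 E8]] := rect_edges.
  rewrite /rect_sum; do 7!(apply: le_trans (modulusD _ _) _; rewrite -lerBrDr).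
  have := hN _ _ E1; have := hN _ _ E2; have := hN _ _ E3; have := hN _ _ E4.
  have := hN _ _ E5; have := hN _ _ E6; have := hN _ _ E7; have := hN _ _ E8.
  lra.
(* Each of the eight edges contributes at least 2 * 2 / 5, since |w|^2 <= 5 on the boundary. *)
have sumIm k : 32 / 5 <= complex.Im (rect_sum (fun w => w^-1) k).
  have low A B : rect_edge A B -> 4 / 5 <= complex.Im (trapezoid (fun w => w^-1) k A B).
    case=> cAB _ hAB.
    have := @Im_trapezoid_inv k A B 5; rewrite cAB => /(_ (ler0n _ _)).
    have -> : 2 * 2 / 5 = 4 / 5 :> R by field.
    apply=> t /hAB /rect_boundary_modulus [h1 ->]; rewrite andbT.
    by rewrite exprn_gt0 // (lt_le_trans ltr01).
  have [[E1 E2 E3 E4] [E5 E6 E7 E8]] := rect_edges.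
  rewrite /rect_sum !ImD.
  have := low _ _ E1; have := low _ _ E2; have := low _ _ E3; have := low _ _ E4.
  have := low _ _ E5; have := low _ _ E6; have := low _ _ E7; have := low _ _ E8.
  lra.
have sumE k : rect_sum H k =
    rect_sum (fun w => g w * w^-1) k - g 0 * rect_sum (fun w => w^-1) k.
  have E A B : trapezoid H k A B = trapezoid (fun w => g w * w^-1) k A B -
      g 0 * trapezoid (fun w => w^-1) k A B.
    rewrite -mulNr -trapezoidZ -trapezoidD; apply: eq_trapezoid => t _.
    by rewrite /H mulrBl mulNr.
  by rewrite /rect_sum !E; ring.
have M0 : 0 <= M.
  by apply: le_trans (modulus_ge0 _) (gM (pt 2 0) _); split => /=;
    rewrite ?normr0 ?ger0_norm ?ler0n ?eqxx.
(* Each edge has length at most 2 and |w| >= 1 on it, which gives 2 * M * 2. *)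
have upper k : md (rect_sum (fun w => g w * w^-1) k) <= 8 * (4 * M).
  apply: sumle => A B [_ lAB hAB].
  apply: (@le_trans _ _ (2 * M * md (B - A))).
    apply: trapezoid_bound => t /hAB hb; have [h1 _] := rect_boundary_modulus hb.
    rewrite modulusM modulusV ler_pdivrMr; last by apply: lt_le_trans h1.
    by apply: le_trans (gM _ hb) _; rewrite ler_peMr.
  have := modulus_ge0 (B - A); nra.
have main (e : R) : 0 < e -> md (g 0) * (32 / 5) <= 4 * e + 32 * M.
  move=> e0.
  have n2 : `|2| = 2 :> R by rewrite ger0_norm.
  have [] := Hsmall 2 0 0 1 e e0; rewrite ?normrN ?normr0 ?normr1 ?n2 ?lexx ?ler01 ?ler0n.
  all: try by [left | right].
    by apply/eqP; lra.
  move=> K1 h1.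
  have [] := Hsmall 0 1 (-2) 0 e e0; rewrite ?normrN ?normr0 ?normr1 ?n2 ?lexx ?ler01 ?ler0n.
  all: try by [left | right].
    by apply/eqP; lra.
  move=> K2 h2.
  have [] := Hsmall (-2) 0 0 (-1) e e0; rewrite ?normrN ?normr0 ?normr1 ?n2 ?lexx ?ler01 ?ler0n.
  all: try by [left | right].
    by apply/eqP; lra.
  move=> K3 h3.
  have [] := Hsmall 0 (-1) 2 0 e e0; rewrite ?normrN ?normr0 ?normr1 ?n2 ?lexx ?ler01 ?ler0n.
  all: try by [left | right].
    by apply/eqP; lra.
  move=> K4 h4.
  pose k := (K1 + K2 + K3 + K4)%N.
  have {}h1 := h1 k ltac:(rewrite /k; lia).
  have {}h2 := h2 k ltac:(rewrite /k; lia).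
  have {}h3 := h3 k ltac:(rewrite /k; lia).
  have {}h4 := h4 k ltac:(rewrite /k; lia).
  have hH : md (rect_sum H k) <= 4 * e.
    rewrite rect_sum_quad; do 3!(apply: le_trans (modulusD _ _) _; rewrite -lerBrDr).
    lra.
  have hI := le_trans (sumIm k) (le_trans (ler_norm _) (Im_le_modulus _)).
  have h0 : md (g 0) * (32 / 5) <= md (g 0 * rect_sum (fun w => w^-1) k).
    by rewrite modulusM ler_wpM2l // modulus_ge0.
  apply: le_trans h0 _.
  have -> : g 0 * rect_sum (fun w => w^-1) k =
      rect_sum (fun w => g w * w^-1) k - rect_sum H k by rewrite sumE; ring.
  by apply: le_trans (modulusBD _ _) _; have := upper k; lra.
apply/ler_addgt0Pl => e e0; have := main (e * (8 / 5)).
by rewrite mulr_gt0 // => /(_ isT); lra.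
Qed.

End CauchyBound.

(** * Uniqueness from vanishing boundary values on a segment *)

Lemma derivable_comp1 (K : numFieldType) (f g : K -> K) w :
  derivable g w 1 -> derivable f (g w) 1 -> derivable (f \o g) w 1.
Proof.
move=> /derivable1_diffP dg /derivable1_diffP df; apply/derivable1_diffP.
exact: differentiable_comp.
Qed.

Lemma derivable1_continuous (K : numFieldType) (g : K -> K) w :
  derivable g w 1 -> {for w, continuous g}.
Proof. by move=> /derivable1_diffP dg; exact: differentiable_continuous. Qed.

Section BoundaryUniqueness.
Variable R : realType.
Local Notation C := (cplx R).
Local Notation md := (@modulus R).
Local Notation pt := (@cpoint R).
Implicit Types (w z : C) (f g : C -> C).

Lemma rect_boundary_pole w : rect_boundary w ->
  1 / 2 <= md (w - pt 0 (- (3 / 2))) /\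
  (complex.Im w != -1 -> 2 <= md (w - pt 0 (- (3 / 2)))).
Proof.
case: w => x y [/=]; rewrite !ler_norml => hx hy hb.
have := Im_le_modulus ((x +i* y)%C - pt 0 (- (3 / 2))).
have := Re_le_modulus ((x +i* y)%C - pt 0 (- (3 / 2))).
rewrite /= subr0 opprK => hre him; split.
  by apply: le_trans him; apply: le_trans (ler_norm _); lra.
move=> /eqP ny; case/orP: hb => /eqP h; first by apply: le_trans hre; rewrite h.
apply: le_trans him; apply: le_trans (ler_norm _).
by move: h; have [y0|y0] := ger0P y; lra.
Qed.

(* The Cauchy bound is applied to f / (w + 3i/2) ^ N: the pole lies just below
   the rectangle, closer to 0 than to the three other sides. *)
Lemma rect_weighted_bound f (e : R) N :
  (forall w, `|complex.Re w| <= 2 -> `|complex.Im w| <= 1 -> derivable f w 1) ->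
  (forall w, rect_boundary w -> md (f w) <= 1) ->
  (forall w, rect_boundary w -> complex.Im w = -1 -> md (f w) <= e) ->
  md (f 0) <= 5 * ((3 / 4) ^+ N + e * 3 ^+ N).
Proof.
move=> fd f1 fe.
set q := pt 0 (- (3 / 2)).
have e0 : 0 <= e.
  apply: le_trans (modulus_ge0 _) (fe (pt 0 (-1)) _ _) => //.
  by split => /=; rewrite ?normrN ?normr0 ?normr1 ?eqxx ?orbT ?ler0n.
pose g := (f * (fun w => (w - q)^-1) ^+ N : C -> C).
have gE w : g w = f w * (w - q) ^- N.
  by rewrite /g /GRing.mul /= exprfctE exprVn.
have gd w : `|complex.Re w| <= 2 -> `|complex.Im w| <= 1 -> derivable g w 1.
  move=> w1 w2; apply: derivableM; first exact: fd.
  apply: derivableX; apply: (derivableV (f := id - cst q)).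
    have Iq : complex.Im (w - q) = complex.Im w + 3 / 2.
      by case: w {w1 w2} => x y /=; rewrite opprK.
    apply/eqP => wq; have := congr1 (@complex.Im R) (wq : w - q = 0).
    by rewrite Iq /=; move: w2; rewrite ler_norml => /andP[]; lra.
  by apply: derivableB; [exact: derivable_id | exact: derivable_cst].
(* The first term serves the three sides with |w - q| >= 2, the second the bottom side, where |w -
   q| >= 1 / 2. *)
have gM w : rect_boundary w -> md (g w) <= 2^-1 ^+ N + e * 2 ^+ N.
  move=> wb; have [lo hi] := rect_boundary_pole wb.
  have md0 : 0 < md (w - q) by apply: lt_le_trans lo; lra.
  rewrite gE modulusM modulusV modulusX -exprVn.
  have [wi|wi] := eqVneq (complex.Im w) (-1).
    rewrite -[X in X <= _]add0r; apply: lerD; first by rewrite exprn_ge0 ?invr_ge0.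
    apply: ler_pM; rewrite ?modulus_ge0 ?exprn_ge0 ?invr_ge0 ?modulus_ge0 ?fe //.
    apply: lerXn2r; rewrite ?nnegrE ?invr_ge0 ?(ltW md0) //.
    by rewrite -[leRHS]invrK lef_pV2 ?posrE //; lra.
  rewrite -[X in X <= _]addr0; apply: lerD; last by rewrite mulr_ge0 ?exprn_ge0.
  rewrite -[X in _ <= X]mul1r.
  apply: ler_pM; rewrite ?modulus_ge0 ?exprn_ge0 ?invr_ge0 ?modulus_ge0 ?f1 //.
  apply: lerXn2r; rewrite ?nnegrE ?invr_ge0 ?(ltW md0) //.
  by rewrite lef_pV2 ?posrE // hi.
have := rect_cauchy_bound gd gM.
(* Multiplying back by |q|^N = (3/2)^N turns 2^-N and 2^N into (3/4)^N and 3^N. *)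
have -> : md (g 0) = md (f 0) * (3 / 2) ^- N.
  rewrite gE modulusM modulusV modulusX sub0r modulusN; congr (_ * (_ ^+ _)^-1).
  apply/eqP; rewrite -(eqrXn2 (n := 2)) ?modulus_ge0 ?divr_ge0 //.
  by rewrite modulus_sqr /= sqrrN expr0n add0r.
rewrite ler_pdivrMr ?exprn_gt0 ?divr_gt0 //.
have -> : 5 * (2^-1 ^+ N + e * 2 ^+ N) * (3 / 2) ^+ N =
    5 * ((3 / 4) ^+ N + e * 3 ^+ N) => //.
rewrite -mulrA; congr (_ * _); rewrite mulrDl -mulrA -!exprMn.
by congr (_ ^+ _ + _ * _ ^+ _); field.
Qed.

(** The rectangle is scaled by r < h and centred at ih, with its bottom so low that |f| <= 4^-N
    there. Both terms of [rect_weighted_bound] then equal (3/4)^N, and N is arbitrary. *)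
Lemma vanishing_boundary_value f (a h : R) : 0 < h -> 2 * h <= a ->
  (forall w, `|complex.Re w| <= a -> 0 < complex.Im w < 2 * h ->
    derivable f w 1 /\ md (f w) <= 1) ->
  (forall e : R, 0 < e -> exists2 t : R, 0 < t & forall w,
    `|complex.Re w| <= a -> 0 < complex.Im w < t -> md (f w) <= e) ->
  f (pt 0 h) = 0.
Proof.
move=> h0 ha fS fe; apply/eqP; rewrite -modulus_eq0.
have key N : md (f (pt 0 h)) <= 10 * (3 / 4) ^+ N.
  have e0 : 0 < 4^-1 ^+ N :> R by rewrite exprn_gt0 ?invr_gt0.
  have [t t0 ft] := fe _ e0.
  (* The first entry keeps r positive; the second puts the bottom at height h - r <= t / 2. *)
  pose r := Num.max (h / 2) (h - t / 2).
  have rlo : h / 2 <= r by rewrite le_max lexx.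
  have rlt : h - t / 2 <= r by rewrite le_max lexx orbT.
  have rh : r < h by rewrite gt_max; lra.
  pose g := f \o (fun w => r%:C%C * w + pt 0 h).
  have gRe w : complex.Re (r%:C%C * w + pt 0 h) = r * complex.Re w.
    by case: w => x y /=; ring.
  have gIm w : complex.Im (r%:C%C * w + pt 0 h) = r * complex.Im w + h.
    by case: w => x y /=; ring.
  have reg w : `|complex.Re w| <= 2 -> `|complex.Im w| <= 1 ->
      `|complex.Re (r%:C%C * w + pt 0 h)| <= a /\
      0 < complex.Im (r%:C%C * w + pt 0 h) < 2 * h.
    rewrite gRe gIm !ler_norml => /andP[? ?] /andP[? ?].
    by split; apply/andP; split; nra.
  have := @rect_weighted_bound g (4^-1 ^+ N) N.
  rewrite /g /= mulr0 add0r => H; apply: (le_trans (H _ _ _)).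
  - move=> w w1 w2; apply: (@derivable_comp1 _ f (fun w => r%:C%C * w + pt 0 h)).
      have : derivable (((cst r%:C%C : C -> C) * id) + cst (pt 0 h)) w 1.
        apply: derivableD; last exact: derivable_cst.
        by apply: derivableM; [exact: derivable_cst | exact: derivable_id].
      by apply.
    by have [r1 r2] := reg w w1 w2; case: (fS _ r1 r2).
  - by move=> w [w1 w2 _]; have [r1 r2] := reg w w1 w2; case: (fS _ r1 r2).
  - move=> w [w1 w2 _] wi; have [r1 /andP[r2 _]] := reg w w1 w2.
    by apply: ft => //; rewrite r2 gIm wi; lra.
  rewrite -exprMn.
  have -> : 4^-1 * 3 = 3 / 4 :> R by field.
  by lra.
apply/eqP/le_anti; rewrite modulus_ge0 andbT.
apply/ler_addgt0Pl => e e0; rewrite addr0.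
have : ((3 / 4 : R) ^+ n @[n --> \oo] --> (0 : R)).
  by apply: cvg_expr; rewrite ger0_norm; lra.
move/cvgrPdist_lt => /(_ (e / 10)); rewrite divr_gt0 // => /(_ isT) [n _ /(_ n (leqnn n))].
rewrite /= sub0r normrN ger0_norm ?exprn_ge0 ?divr_ge0 // => hn.
by apply: le_trans (key n) _; lra.
Qed.

End BoundaryUniqueness.

(** * Coefficients of Moebius maps preserving the circle *)

Section UnitaryForm.
Variable K : numClosedFieldType.
Implicit Types a b c d z : K.

Let conjM x y : (x * y)^* = x^* * y^* :> K. Proof. exact: rmorphM. Qed.

Let conjD x y : (x + y)^* = x^* + y^* :> K. Proof. exact: rmorphD. Qed.

(** Squaring at z = 1, -1 and i gives |a|^2 + |b|^2 = |c|^2 + |d|^2 and a b^* = c d^*. With the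
    determinant this yields a k = d^* and c k = b^* for k = |d|^2 - |b|^2 > 0; substituting back
    gives k^2 = 1, so k = 1. *)
Lemma circle_isometry_coefs a b c d :
  a * d - b * c = 1 -> `|b| < `|d| ->
  (forall z, `|z| = 1 -> `|a * z + b| = `|c * z + d|) ->
  c = b^* /\ d = a^*.
Proof.
move=> det bd iso.
have sq z : `|z| = 1 -> (a * z + b) * (a^* * z^* + b^*) =
    (c * z + d) * (c^* * z^* + d^*).
  by move=> /iso /(congr1 (fun t => t ^+ 2)); rewrite !normCK !rmorphD !rmorphM.
have := sq 1 (normr1 _); have := sq (-1) (normrN1 _); have := sq 'i (normCi _).
rewrite rmorphN conjCi !rmorph1 => hi hn h1.
have i2 : 'i * 'i = -1 :> K by rewrite -expr2 sqrCi.
have S : a * a^* + b * b^* = c * c^* + d * d^*.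
  apply: (mulfI (_ : 2 != 0)); first by rewrite pnatr_eq0.
  have -> : 2 * (a * a^* + b * b^*) = (a * 1 + b) * (a^* * 1 + b^*) +
    (a * -1 + b) * (a^* * -1 + b^*) by ring.
  by rewrite h1 hn; ring.
have T : a * b^* + a^* * b = c * d^* + c^* * d.
  apply: (mulfI (_ : 2 != 0)); first by rewrite pnatr_eq0.
  have -> : 2 * (a * b^* + a^* * b) = (a * 1 + b) * (a^* * 1 + b^*) -
    (a * -1 + b) * (a^* * -1 + b^*) by ring.
  by rewrite h1 hn; ring.
have U : a * b^* - a^* * b = c * d^* - c^* * d.
  have E x y x' y' : (x * 'i + y) * (x' * - 'i + y') =
      x * x' * - ('i * 'i) + y * y' + 'i * (x * y' - x' * y) :> K by ring.
  move: hi; rewrite !E i2 opprK !mulr1 S => /addrI h.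
  by apply: (mulfI (neq0Ci K)); exact: h.
have ab : a * b^* = c * d^*.
  apply: (mulfI (_ : 2 != 0)); first by rewrite pnatr_eq0.
  have -> : 2 * (a * b^*) = (a * b^* + a^* * b) + (a * b^* - a^* * b) by ring.
  by rewrite T U; ring.
set k := d * d^* - b * b^*.
have ak : a * k = d^*.
  have -> : a * k = (a * d) * d^* - (a * b^*) * b by rewrite /k; ring.
  rewrite ab -(subrK (b * c) (a * d)) det; ring.
have ck : c * k = b^*.
  have -> : c * k = d * (c * d^*) - (b * c) * b^* by rewrite /k; ring.
  rewrite -ab -[X in _ - X * _](subKr (a * d)) det; ring.
have k0 : 0 < k.
  by rewrite /k -!normCK subr_gt0 ltrXn2r // ?nnegrE ?normr_ge0.
have kJ : k^* = k by rewrite conj_Creal // gtr0_real.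
have dk : d = a^* * k by rewrite -[LHS]conjCK -ak conjM kJ.
have bk : b = c^* * k by rewrite -[LHS]conjCK -ck conjM kJ.
have n0 : a * a^* - c * c^* != 0.
  have kE : k = a^* * k * (a * k) - c^* * k * (c * k) by rewrite ak ck -dk -bk.
  apply/eqP => h0; move: k0; rewrite kE.
  have -> : a^* * k * (a * k) - c^* * k * (c * k) = k ^+ 2 * (a * a^* - c * c^*) by ring.
  by rewrite h0 mulr0 ltxx.
have k1 : k = 1.
  have : (k ^+ 2 - 1) * (a * a^* - c * c^*) = 0.
    have -> : (k ^+ 2 - 1) * (a * a^* - c * c^*) =
      (c * c^* + a^* * k * (a * k)) - (a * a^* + c^* * k * (c * k)) by ring.
    by rewrite -bk -dk ak ck S subrr.
  move/eqP; rewrite mulf_eq0 (negPf n0) orbF subr_eq0 sqrf_eq1 => /orP[/eqP//|/eqP k1].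
  by move: k0; rewrite k1 oppr_gt0 ltr10.
by split; [rewrite -ck k1 mulr1 | rewrite dk k1 mulr1].
Qed.

Lemma unitary_norm_sub a b z : `|b^* * z + a^*| ^+ 2 - `|a * z + b| ^+ 2 =
  (`|a| ^+ 2 - `|b| ^+ 2) * (1 - `|z| ^+ 2).
Proof. by rewrite !normCK !conjD !conjM !conjCK; ring. Qed.

End UnitaryForm.

(** * Estimates for Moebius maps of the disk *)

Section DiskMobius.
Variable R : realType.
Local Notation C := (cplx R).
Local Notation md := (@modulus R).
Implicit Types a b z w : C.

Lemma modulus_conj z : md z^* = md z.
Proof. by apply: (@complexI R); rewrite -!normE norm_conjC. Qed.

Lemma unitary_modulus_sub a b z : md a ^+ 2 - md b ^+ 2 = 1 ->
  md (b^* * z + a^*) ^+ 2 - md (a * z + b) ^+ 2 = 1 - md z ^+ 2.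
Proof.
move=> ab; apply: (@complexI R); have := unitary_norm_sub a b z.
rewrite !normE -!rmorphXn -!rmorphB => ->.
by rewrite ab rmorph1 mul1r.
Qed.

Lemma unitary_denom_neq0 a b z : md a ^+ 2 - md b ^+ 2 = 1 -> md z < 1 ->
  b^* * z + a^* != 0.
Proof.
move=> ab z1; apply/eqP => h0; have := unitary_modulus_sub z ab.
rewrite h0 modulus0 expr0n /=.
have := sqr_ge0 (md (a * z + b)); have := modulus_ge0 z; nra.
Qed.

Lemma unitary_image a b z : md a ^+ 2 - md b ^+ 2 = 1 -> md z < 1 ->
  (1 - md ((a * z + b) / (b^* * z + a^*)) ^+ 2) * md (b^* * z + a^*) ^+ 2 =
  1 - md z ^+ 2.
Proof.
move=> ab z1; rewrite -(unitary_modulus_sub z ab) modulusM modulusV.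
have : md (b^* * z + a^*) != 0 by rewrite modulus_eq0 unitary_denom_neq0.
by move=> n0; field.
Qed.

(** For the map g with denominator n at z, g z - g 0 = z / (a^* n) and 1 - |g z|^2 = (1 - |z|^2) /
    |n|^2, so the claim reduces to |z| <= 1 <= |a|. Hence g z and g 0 are close when g z is near the
    circle and z stays in a compact set. *)
Lemma unitary_displacement a b z : md a ^+ 2 - md b ^+ 2 = 1 -> md z < 1 ->
  md ((a * z + b) / (b^* * z + a^*) - b / a^*) ^+ 2 * (1 - md z ^+ 2) <=
  1 - md ((a * z + b) / (b^* * z + a^*)) ^+ 2.
Proof.
move=> ab z1; rewrite -(unitary_image ab z1).
set n := b^* * z + a^*; set w := (a * z + b) / n.
have n0 : n != 0 by exact: unitary_denom_neq0.
have a0 : a^* != 0.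
  by have := unitary_denom_neq0 (z := 0) ab; rewrite mulr0 add0r; apply; rewrite modulus0.
have an : a * a^* - b * b^* = 1.
  by rewrite -!normCK !normE -!rmorphXn -rmorphB ab.
have -> : w - b / a^* = z / (a^* * n).
  rewrite /w; have -> : a * z + b = (z + b * n) / a^*.
    apply: (mulIf a0); rewrite mulfVK //.
    have -> : (a * z + b) * a^* = (a * a^* - b * b^*) * z + b * n.
      by rewrite /n; ring.
    by rewrite an mul1r.
  by field; apply/andP.
have e1 : 1 <= md a ^+ 2 by have := sqr_ge0 (md b); lra.
have [m0 m1] : 0 <= md z ^+ 2 /\ md z ^+ 2 <= 1.
  by have := modulus_ge0 z; split; nra.
have w1 : 0 <= 1 - md w ^+ 2.
  have := unitary_image ab z1; rewrite -/n -/w => E.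
  have np : 0 < md n ^+ 2 by rewrite exprn_gt0 // modulus_gt0.
  by rewrite -(pmulr_lge0 _ np) E subr_ge0.
have -> : md (z / (a^* * n)) ^+ 2 * ((1 - md w ^+ 2) * md n ^+ 2) =
   md z ^+ 2 / md a ^+ 2 * (1 - md w ^+ 2).
  rewrite !modulusM modulusV modulusM modulus_conj.
  have : md n != 0 by rewrite modulus_eq0.
  have : md a != 0 by rewrite -modulus_conj modulus_eq0.
  by move=> ? ?; field; apply/andP.
rewrite -[X in _ <= X]mul1r ler_wpM2r // ler_pdivrMr; last lra.
by rewrite mul1r; lra.
Qed.

End DiskMobius.

(** * Moebius maps on the sphere and matrices of a Fuchsian group *)

Section MobiusAction.
Variable R : realType.
Local Notation C := (cplx R).
Local Notation md := (@modulus R).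
Implicit Types (u v w z : C) (A B : 'M[C]_2) (x : sphere R).

(** The point [u : v] of the projective line, on which matrices act linearly. The pair (0, 0) gets
    the default value [None], whence the side conditions below. *)
Definition homogeneous u v : sphere R := if v == 0 then None else Some (u / v).

Lemma mobius_homogeneous A u v : (u != 0) || (v != 0) ->
  mobius A (homogeneous u v) =
  homogeneous (A 0 0 * u + A 0 1 * v) (A 1 0 * u + A 1 1 * v).
Proof.
rewrite /homogeneous; have [->|v0] /= := eqVneq v 0.
  rewrite orbF => u0; rewrite !mulr0 !addr0 mulf_eq0 (negPf u0) orbF.
  by case: ifPn => // ?; rewrite -mulf_div divff // mulr1.
move=> _.
have -> : A 1 0 * u + A 1 1 * v = (A 1 0 * (u / v) + A 1 1) * v.
  by rewrite mulrDl -mulrA mulfVK.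
have -> : A 0 0 * u + A 0 1 * v = (A 0 0 * (u / v) + A 0 1) * v.
  by rewrite mulrDl -mulrA mulfVK.
rewrite mulf_eq0 (negPf v0) orbF.
by case: ifPn => // ?; rewrite -mulf_div divff // mulr1.
Qed.

Lemma sphere_homogeneous x :
  exists u v, (u != 0) || (v != 0) /\ x = homogeneous u v.
Proof.
case: x => [z|]; last by exists 1, 0; rewrite /homogeneous eqxx oner_neq0.
by exists z, 1; rewrite /homogeneous oner_eq0 orbT divr1.
Qed.

Lemma mul2_mxE A B i j : (A *m B) i j = A i 0 * B 0 j + A i 1 * B 1 j.
Proof.
rewrite mxE !big_ord_recl big_ord0 addr0.
by congr (_ * _ + _ i _ * B _ j); apply/val_inj.
Qed.

Lemma det_mx2 A : \det A = A 0 0 * A 1 1 - A 0 1 * A 1 0.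
Proof.
rewrite (expand_det_row A 0) !big_ord_recl big_ord0 addr0 /cofactor !det_mx11 !mxE /=.
rewrite expr0 mul1r expr1 mulN1r mulrN.
by congr (_ * A _ _ - A _ _ * A _ _); apply/val_inj.
Qed.

(** In homogeneous coordinates this is associativity of the matrix action; invertibility of B rules
    out the pair (0, 0) as intermediate value. *)
Lemma mobiusM A B x : \det B != 0 ->
  mobius (A *m B) x = mobius A (mobius B x).
Proof.
move=> dB; have [u [v [uv ->]]] := sphere_homogeneous x.
rewrite det_mx2 in dB.
suff uv' : (B 0 0 * u + B 0 1 * v != 0) || (B 1 0 * u + B 1 1 * v != 0).
  rewrite (mobius_homogeneous _ uv) (mobius_homogeneous B uv).
  rewrite (mobius_homogeneous A uv') !mul2_mxE.
  by congr homogeneous; ring.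
apply: contraT; rewrite negb_or !negbK => /andP[/eqP h1 /eqP h2].
have e1 : (B 0 0 * B 1 1 - B 0 1 * B 1 0) * u = 0.
  have -> : (B 0 0 * B 1 1 - B 0 1 * B 1 0) * u =
    (B 0 0 * u + B 0 1 * v) * B 1 1 - (B 1 0 * u + B 1 1 * v) * B 0 1 by ring.
  by rewrite h1 h2; ring.
have e2 : (B 0 0 * B 1 1 - B 0 1 * B 1 0) * v = 0.
  have -> : (B 0 0 * B 1 1 - B 0 1 * B 1 0) * v =
    (B 1 0 * u + B 1 1 * v) * B 0 0 - (B 0 0 * u + B 0 1 * v) * B 1 0 by ring.
  by rewrite h1 h2; ring.
move/eqP: e1; move/eqP: e2; rewrite !mulf_eq0 (negPf dB) /= => v0 u0.
by rewrite u0 v0 in uv.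
Qed.

Lemma mobius1 x : mobius (1%:M : 'M[C]_2) x = x.
Proof.
by case: x => [z|] /=; rewrite !mxE /= ?eqxx // mul0r add0r oner_eq0 mul1r addr0 divr1.
Qed.

Lemma unit_diskP z : @unit_disk R (Some z) <-> md z < 1.
Proof.
rewrite /unit_disk /=; split.
  by case=> w /= + [<-]; rewrite norm_lt_modulus.
by move=> h; exists z => //=; rewrite norm_lt_modulus.
Qed.

Lemma unit_circleP z : @unit_circle R (Some z) <-> md z = 1.
Proof.
rewrite /unit_circle /=; split.
  by case=> w /= + [<-]; rewrite normE => /(@complexI R).
by move=> h; exists z => //=; rewrite normE h.
Qed.

Variable Gamma : set (sphere R -> sphere R).
Hypothesis FG : fuchsian Gamma.

Lemma fuchsian_disk g x : Gamma g -> unit_disk (g x) <-> unit_disk x.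
Proof.
case: FG => [[_ _ inv] act _] Gg; have [_ gD] := act _ Gg.
have [h [Gh gh hg]] := inv _ Gg; have [_ hD] := act _ Gh.
split; last by move=> dx; rewrite -gD; exists x.
by move=> dx; rewrite -(gh x) -hD; exists (g x).
Qed.

(** Preserving the disk and its complement gives |az + b| < |cz + d| for |z| < 1 and the reverse
    weak inequality for |z| >= 1. Approaching the circle radially yields equality there, and
    [circle_isometry_coefs] applies. *)
Lemma fuchsian_unitary A : \det A = 1 -> Gamma (mobius A) ->
  [/\ A 1 0 = (A 0 1)^*, A 1 1 = (A 0 0)^* &
      md (A 0 0) ^+ 2 - md (A 0 1) ^+ 2 = 1].
Proof.
rewrite det_mx2; set a := A 0 0; set b := A 0 1; set c := A 1 0; set d := A 1 1.
move=> det GA; have disk z := fuchsian_disk (Some z) GA.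
have lt_in z : md z < 1 -> md (a * z + b) < md (c * z + d).
  move=> z1; have : unit_disk (mobius A (Some z)) by apply/disk/unit_diskP.
  rewrite /= -/a -/b -/c -/d; case: ifPn => [_ [w _ //]|n0].
  move/unit_diskP; rewrite modulusM modulusV ltr_pdivrMr ?mul1r // modulus_gt0 //.
have le_out z : 1 <= md z -> md (c * z + d) <= md (a * z + b).
  move=> z1; rewrite leNgt; apply/negP => h.
  have n0 : c * z + d != 0.
    by rewrite -modulus_gt0; apply: le_lt_trans h; exact: modulus_ge0.
  suff /disk/unit_diskP : unit_disk (mobius A (Some z)) by rewrite ltNge z1.
  rewrite /= -/a -/b -/c -/d (negPf n0); apply/unit_diskP.
  by rewrite modulusM modulusV ltr_pdivrMr ?mul1r // modulus_gt0.
have [cb da] : c = b^* /\ d = a^*.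
  apply: circle_isometry_coefs => //.
    have := lt_in 0; rewrite modulus0 ltr01 !mulr0 !add0r => /(_ isT).
    by rewrite !normE ltcR.
  move=> z; rewrite !normE => /(@complexI R) z1; congr (_%:C%C).
  apply/le_anti; rewrite le_out ?z1 // andbT.
  apply/ler_addgt0Pl => e e0.
  (* Small enough that s < 1 and that moving z to (1 - s) z changes both sides by at most e in
     total. *)
  pose s := e / (e + md a + md c + 1).
  have D0 : 0 < e + md a + md c + 1.
    by have := modulus_ge0 a; have := modulus_ge0 c; lra.
  have s0 : 0 < s by rewrite divr_gt0.
  have s1 : s < 1.
    rewrite ltr_pdivrMr // mul1r.
    by have := modulus_ge0 a; have := modulus_ge0 c; lra.
  have sS : s * (md a + md c) <= e.
    have sD : s * (e + md a + md c + 1) = e by rewrite divfK // gt_eqF.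
    by have : 0 <= s * (e + 1); [rewrite mulr_ge0 // ltW //; lra | lra].
  have hw : md ((1 - s)%:C%C * z : C) < 1.
    by rewrite modulusM modulus_real z1 mulr1 ger0_norm; lra.
  have hin := lt_in _ hw.
  have ms : md (s%:C%C : C) = s by rewrite modulus_real gtr0_norm.
  have E1 : a * z + b = (a * ((1 - s)%:C%C * z) + b) + a * (s%:C%C * z).
    by rewrite rmorphB /= rmorph1; ring.
  have E2 : c * ((1 - s)%:C%C * z) + d = (c * z + d) - c * (s%:C%C * z).
    by rewrite rmorphB /= rmorph1; ring.
  have := modulusD (a * ((1 - s)%:C%C * z) + b) (a * (s%:C%C * z)).
  have := modulusBD (c * z + d) (c * (s%:C%C * z)).
  rewrite -E1 -E2 !(modulusM _ (_ * z)) !(modulusM s%:C%C) z1 ms; lra.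
split=> //; apply: (@complexI R).
rewrite rmorphB !rmorphXn rmorph1 -det cb da.
by have := normCK a; have := normCK b; rewrite !normE => -> ->.
Qed.

End MobiusAction.

(** * The limit set lies in the unit circle *)

Section LimitSet.
Variable R : realType.
Local Notation C := (cplx R).
Local Notation md := (@modulus R).
Local Notation pt := (@cpoint R).
Implicit Types (z w : C) (A B : 'M[C]_2).

(** Neighbourhoods of infinity come from complements of closed compact sets, so this keeps the
    orbits away from infinity. *)
Lemma compact_closed_disk : compact [set z : C | md z <= 1] /\
  closed [set z : C | md z <= 1].
Proof.
have cl : closed [set z : C | md z <= 1].
  rewrite -[X in closed X]setCK closedC openE => z /negP.
  rewrite -ltNge => z1; apply/nbhs_modulusP; exists (md z - 1); first by lra.
  move=> w wz /=; apply/negP; rewrite -ltNge.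
  by have := modulus_subr_le z w; rewrite modulusB; lra.
split=> //.
pose f (p : R * R) := pt p.1 p.2.
have fc : continuous f.
  move=> p U /nbhs_modulusP [d d0 dU]; apply/nbhs_ballP.
  exists (d / 2) => [|q]; first by rewrite /= divr_gt0.
  rewrite /ball /= /prod_ball -!ball_normE /= => -[h1 h2]; apply: dU.
  apply: le_lt_trans (modulus_le_ReIm _) _ => /=.
  by rewrite distrC (distrC q.2); lra.
apply: (@subclosed_compact _ _ (f @` (`[-1, 1] `*` `[-1, 1]))) => //.
  apply: continuous_compact; last by apply: compact_setX; exact: segment_compact.
  by apply: continuous_subspaceT.
move=> z /= z1; exists (complex.Re z, complex.Im z); last by case: z {z1}.
have := Re_le_modulus z; have := Im_le_modulus z; rewrite !ler_norml.
by rewrite /= !in_itv /=; lra.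
Qed.

Lemma nbhs_someP z (U : set (sphere R)) :
  nbhs (Some z : sphere R) U <-> exists2 d : R, 0 < d &
    forall w, md (w - z) < d -> U (Some w).
Proof. exact: (@nbhs_modulusP R z (Some @^-1` U)). Qed.

Let coords A := ((complex.Re (A 0 0), complex.Im (A 0 0)),
                 (complex.Re (A 0 1), complex.Im (A 0 1))).

(* Controlling the first rows is enough: the second row of a matrix preserving the
   disk is conjugate to the first. *)
Lemma cluster_close_pair (b : R) (S : R -> set 'M[C]_2) :
  (forall e A, 0 < e -> S e A -> md (A 0 0) <= b /\ md (A 0 1) <= b) ->
  (forall e, 0 < e -> S e !=set0) ->
  (forall e e' A, e <= e' -> S e A -> S e' A) ->
  exists p : 'M[C]_2, forall d e, 0 < d -> 0 < e ->
    exists A, S e A /\ (md (A 0 0 - p 0 0) < d /\ md (A 0 1 - p 0 1) < d).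
Proof.
move=> Sb S0 Sm.
pose K := (`[- b, b] `*` `[- b, b]) `*` (`[- b, b] `*` `[- b, b]) : set (R * R * (R * R)).
have cK : compact K by do 3?apply: compact_setX; exact: segment_compact.
(* The sets [S e] decrease with e, so their first rows generate a filter on a compact box; [p]
   records a cluster point. *)
pose F := filter_from [set e : R | 0 < e] (fun e => coords @` S e).
have FF : ProperFilter F.
  apply: filter_from_proper; last by move=> e /= /S0 [A SA]; exists (coords A), A.
  apply: filter_from_filter; first by exists 1 => /=.
  move=> i j /= i0 j0; exists (Num.min i j); first by rewrite /= lt_min i0.
  move=> _ [A SA <-]; split; exists A => //; apply: Sm SA; by rewrite ge_min lexx ?orbT.
have FK : F K.
  exists 1 => //= _ [A /(Sb _ _ ltr01) [h1 h2] <-].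
  have := le_trans (Re_le_modulus _) h1; have := le_trans (Im_le_modulus _) h1.
  have := le_trans (Re_le_modulus _) h2; have := le_trans (Im_le_modulus _) h2.
  rewrite !ler_norml /K /= !in_itv /= => -> -> -> -> //.
have [[[x y] [s t]] [_ cl]] := cK F FF FK.
exists (\matrix_(i, j) if j == 0 then pt x y else pt s t) => d e d0 e0.
have [||_ [[A SA <-] [[/= h1 h2] [/= h3 h4]]]] :=
    cl (coords @` S e) (ball ((x, y), (s, t)) (d / 2)).
- by exists e.
- by apply: nbhsx_ballx; rewrite divr_gt0.
exists A; split=> //; move: h1 h2 h3 h4; rewrite -!ball_normE /= !mxE /= => h1 h2 h3 h4.
split; apply: le_lt_trans (modulus_le_ReIm _) _.
  move: h1 h2; case: (A 0 0) => u v /=.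
  by rewrite distrC (distrC y); lra.
move: h3 h4; case: (A 0 1) => u v /=.
by rewrite distrC (distrC t); lra.
Qed.

Variable Gamma : set (sphere R -> sphere R).
Hypothesis FG : fuchsian Gamma.

(** For determinant 1 the adjugate is the inverse, so the product represents a quotient of two group
    elements. *)
Lemma fuchsian_mul_adj A B : \det A = 1 -> Gamma (mobius A) ->
  \det B = 1 -> Gamma (mobius B) ->
  \det (B *m \adj A) = 1 /\ Gamma (mobius (B *m \adj A)).
Proof.
move=> dA GA dB GB; have [[_ mul inv] _ _] := FG.
have dadj : \det (\adj A) = 1.
  have := congr1 determinant (mul_mx_adj A); rewrite det_mulmx dA !mul1r => ->.
  by rewrite det1.
split; first by rewrite det_mulmx dB dadj mulr1.
have [h [Gh gh hg]] := inv _ GA.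
have -> : mobius (B *m \adj A) = mobius B \o h; last exact: mul.
apply/funext => x /=; rewrite mobiusM ?dadj ?oner_neq0 //; congr mobius.
by rewrite -[LHS]gh -mobiusM ?dadj ?oner_neq0 // mul_mx_adj dA mobius1.
Qed.

(** Isolation of the identity is enough, since two nearby elements are compared through their
    quotient. *)
Lemma fuchsian_discrete : exists2 d : R, 0 < d &
  forall A, \det A = 1 -> Gamma (mobius A) ->
    (forall i j, md (A i j - (1%:M : 'M[C]_2) i j) < d) -> A = 1%:M.
Proof.
have [[Gid _ _] _ iso] := FG; move: iso => /=.
set G := [set A : 'M[C]_2 | _] => iso.
have G1 : G 1%:M.
  split; first by rewrite det1.
  by have -> : mobius (1%:M : 'M[C]_2) = id by [apply/funext => x; rewrite mobius1].
have [_ [V [P PV sV] VG]] : isolated G 1%:M by rewrite iso.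
have hd i j : exists2 d : R, 0 < d & forall z, md (z - (1%:M : 'M[C]_2) i j) < d -> P i j z.
  exact/nbhs_modulusP/PV.
have [d00 p00 h00] := hd 0 0; have [d01 p01 h01] := hd 0 1.
have [d10 p10 h10] := hd 1 0; have [d11 p11 h11] := hd 1 1.
exists (Num.min (Num.min d00 d01) (Num.min d10 d11)).
  by rewrite !lt_min p00 p01 p10 p11.
move=> A dA GA hA.
suff : (V `&` G) A by rewrite VG.
split=> //; apply: sV => i j; have := hA i j; rewrite !lt_min => /andP[/andP[a1 a2] /andP[a3 a4]].
have i2 (k : 'I_2) : k = 0 \/ k = 1.
  by case: k => -[|[|//]] p; [left | right]; apply/val_inj.
by move: a1 a2 a3 a4; case: (i2 i) => ->; case: (i2 j) => -> ? ? ? ?;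
  [exact: h00 | exact: h01 | exact: h10 | exact: h11].
Qed.


Lemma ord2P (k : 'I_2) : k = 0 \/ k = 1.
Proof. by case: k => -[|[|//]] p; [left | right]; apply/val_inj. Qed.

Lemma modulus_adj A i j (b : R) : (forall k l, md (A k l) <= b) ->
  md (\adj A i j) <= b.
Proof.
move=> hA; rewrite mxE /cofactor det_mx11 !mxE modulusM modulusX modulusN.
by rewrite modulus1 expr1n mul1r.
Qed.

(** By [unitary_image] the denominator n at z satisfies n^2 * (1 - |w|^2) <= 1, so n is bounded in
    terms of r; and n >= |a| - |b| |z| >= |a| (1 - |z|) as |b| <= |a|. *)
Lemma fuchsian_entry_bound z (r : R) : md z < 1 -> r < 1 ->
  exists b : R, forall A w, \det A = 1 -> Gamma (mobius A) ->
    mobius A (Some z) = Some w -> md w <= r -> forall i j, md (A i j) <= b.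
Proof.
move=> z1 r1; exists ((1 + (1 - r)^-1) / (1 - md z)) => A w dA GA Aw wr.
have [c01 d01 ab] := fuchsian_unitary FG dA GA.
set b := _ / _.
have n0 := unitary_denom_neq0 ab z1.
have wE : w = (A 0 0 * z + A 0 1) / ((A 0 1)^* * z + (A 0 0)^*).
  by move: Aw; rewrite /= c01 d01 (negPf n0) => -[].
have := unitary_image ab z1; rewrite -wE.
set n := md (_ + _) => im.
have nlow : md (A 0 0) - md (A 0 1) * md z <= n.
  rewrite /n -[X in X - _]modulus_conj -[X in _ - X * _]modulus_conj -modulusM.
  have := modulus_subr_le (A 0 0)^* (- ((A 0 1)^* * z)).
  by rewrite modulusN opprK (addrC (A 0 0)^*).
have a0 := modulus_ge0 (A 0 0); have b0 := modulus_ge0 (A 0 1).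
have w0 := modulus_ge0 w; have z0 := modulus_ge0 z.
have ba : md (A 0 1) <= md (A 0 0) by nra.
have nn : 0 <= n by exact: modulus_ge0.
(* The inequality n <= 1 + n^2 avoids a square root. *)
have nup : n <= 1 + (1 - r)^-1.
  have n2 : n ^+ 2 * (1 - r) <= 1.
    have : (1 - r) <= 1 - md w ^+ 2 by nra.
    have := sqr_ge0 n; have := sqr_ge0 (md z); nra.
  have : n ^+ 2 <= (1 - r)^-1 by rewrite -[X in _ <= X]mul1r ler_pdivlMr // subr_gt0.
  nra.
have ub : md (A 0 0) <= b by rewrite ler_pdivlMr ?subr_gt0 //; nra.
move=> i j; case: (ord2P i) => ->; case: (ord2P j) => -> //.
- exact: le_trans ub.
- by rewrite c01 modulus_conj; exact: le_trans ub.
- by rewrite d01 modulus_conj.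
Qed.

(** The orbit stays in the open disk, which excludes infinity and |x| > 1. Accumulation at x inside
    the disk would give infinitely many group elements with bounded entries, two of them so close
    that discreteness forces them to be equal. *)
Lemma limit_set_sub_circle : limit_set Gamma `<=` @unit_circle R.
Proof.
move=> x [_ [z /= zD <-] lim].
have {}zD : md z < 1 by apply/unit_diskP; exists z.
have orb y : group_orbit Gamma (Some z) y -> exists2 A, y = mobius A (Some z) &
    [/\ \det A = 1, Gamma (mobius A) & exists2 w, y = Some w & md w < 1].
  case=> g Gg <-; have [_ act _] := FG; have [[A dA gA] gD] := act _ Gg.
  exists A; first by rewrite gA.
  split=> //; first by rewrite -gA.
  have /(fuchsian_disk FG (Some z) Gg) : unit_disk (Some z : sphere R) by apply/unit_diskP.
  by case: (g (Some z)) => [w /unit_diskP|[]//]; exists w.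
case: x lim => [x|] lim; last first.
  have [cK clK] := compact_closed_disk.
  have [|y [_ /orb[_ _ [_ _ [w -> w1]]] [[v /= nv [wv]]|//]]] :=
    lim ((Some @` (~` [set z : C | md z <= 1])) `|` [set None]).
    by exists [set z : C | md z <= 1].
  by exfalso; apply: nv; rewrite wv ltW.
apply/unit_circleP; have [x1|x1|//] := ltgtP (md x) 1; exfalso; last first.
  have [|y [_ /orb[_ _ [_ _ [w -> w1]]] /= wx]] := lim (Some @` [set w | md (w - x) < md x - 1]).
    by apply/nbhs_someP; exists (md x - 1); [rewrite subr_gt0 | move=> w wx; exists w].
  case: wx => v /= + [vw]; rewrite vw => wx.
  by have := modulus_subr_le x w; rewrite modulusB; lra.
pose r := (1 + md x) / 2.
have r1 : r < 1 by rewrite /r; lra.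
have [b hb] := fuchsian_entry_bound zD r1.
pose S (e : R) := [set A : 'M[C]_2 | [/\ \det A = 1, Gamma (mobius A) &
  exists w, [/\ mobius A (Some z) = Some w, 0 < md (w - x), md (w - x) < e &
     md w <= r]]].
have [] := @cluster_close_pair b S.
- by move=> e A _ [dA GA [w [Aw _ _ wr]]]; split; exact: (hb A w).
- move=> e e0.
  have [|y [yx /orb[A yA [dA GA [w yw w1]]] yU]] :=
    lim (Some @` [set w | md (w - x) < Num.min e ((1 - md x) / 2)]).
    apply/nbhs_someP; exists (Num.min e ((1 - md x) / 2)).
      by rewrite lt_min e0 divr_gt0 // subr_gt0.
    by move=> w wx; exists w.
  exists A; split=> //; exists w; rewrite -yA -yw.
  case: yU => v /= + vy; have [->] : Some v = Some w by rewrite vy yw.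
  rewrite lt_min => /andP[we wx]; split=> //.
    by rewrite modulus_gt0 subr_eq0; apply: contra yx => /eqP <-; rewrite yw.
  by have := modulus_subr_le w x; rewrite /r; lra.
- move=> e e' A ee' [dA GA [w [? ? we ?]]]; split=> //; exists w.
  by split=> //; exact: lt_le_trans ee'.
move=> p hp.
have [d0 d00 disc] := fuchsian_discrete.
have [A0 [[dA0 GA0 [w0 [Aw0 _ _ wr0]]] _]] := hp 1 1 ltr01 ltr01.
have b0 : 0 <= b by apply: le_trans (modulus_ge0 _) (hb _ _ dA0 GA0 Aw0 wr0 0 0).
(* Two rows within d of [p] differ by less than 2 * d, so the entries of B A^-1 - 1 are at most 2 *
   (2 * d * b) < d0. *)
pose d := d0 / (4 * (b + 1)).
have dp : 0 < d by rewrite divr_gt0 // mulr_gt0 //; lra.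
have [A [[dA GA [w [Aw wx _ wr]]] [pA0 pA1]]] := hp d 1 dp ltr01.
(* B is chosen to send z strictly closer to x than A does, so that B = A is impossible. *)
have [B [[dB GB [v [Bv _ vw vr]]] [pB0 pB1]]] := hp d _ dp wx.
have [cA eA _] := fuchsian_unitary FG dA GA.
have [cB eB _] := fuchsian_unitary FG dB GB.
have near2 i j : md (B i j - A i j) < 2 * d.
  have n0 : md (B 0 0 - A 0 0) < 2 * d.
    have := modulus_triangle (B 0 0) (p 0 0) (A 0 0).
    by rewrite (modulusB (p 0 0)); lra.
  have n1 : md (B 0 1 - A 0 1) < 2 * d.
    have := modulus_triangle (B 0 1) (p 0 1) (A 0 1).
    by rewrite (modulusB (p 0 1)); lra.
  have conjB (s t : C) : md (s^* - t^*) = md (s - t).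
    by rewrite -[RHS]modulus_conj; congr md; rewrite [RHS]rmorphB.
  by case: (ord2P i) => ->; case: (ord2P j) => ->; rewrite // ?cA ?cB ?eA ?eB conjB.
have [dC GC] := fuchsian_mul_adj dA GA dB GB.
have C1 : B *m \adj A = 1%:M.
  apply: disc => // i j.
  have -> : (1%:M : 'M[C]_2) = A *m \adj A by rewrite mul_mx_adj dA.
  rewrite !mul2_mxE.
  have -> : B i 0 * \adj A 0 j + B i 1 * \adj A 1 j -
      (A i 0 * \adj A 0 j + A i 1 * \adj A 1 j) =
    (B i 0 - A i 0) * \adj A 0 j + (B i 1 - A i 1) * \adj A 1 j by ring.
  apply: le_lt_trans (modulusD _ _) _; rewrite !modulusM.
  have a0 := modulus_adj 0 j (hb _ _ dA GA Aw wr).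
  have a1 := modulus_adj 1 j (hb _ _ dA GA Aw wr).
  have := near2 i 0; have := near2 i 1.
  have := modulus_ge0 (\adj A 0 j); have := modulus_ge0 (\adj A 1 j).
  have := modulus_ge0 (B i 0 - A i 0); have := modulus_ge0 (B i 1 - A i 1).
  have dE : d * (4 * (b + 1)) = d0 by rewrite divfK // gt_eqF // mulr_gt0 //; lra.
  move=> p1 p2 q1 q2 l1 l2.
  have m1 : md (B i 1 - A i 1) * md (\adj A 1 j) <= 2 * d * b by apply: ler_pM => //; exact: ltW.
  have m0 : md (B i 0 - A i 0) * md (\adj A 0 j) <= 2 * d * b by apply: ler_pM => //; exact: ltW.
  by lra.
have BA : B = A by rewrite -[RHS]mul1mx -C1 -mulmxA mul_adj_mx dA mulmx1.
by move: Bv vw; rewrite BA Aw => -[->]; rewrite ltxx.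
Qed.

End LimitSet.

(** * The generalized Cantor set is totally disconnected *)

Section CantorGaps.
Variables (R : realType) (q : nat -> R).
Hypothesis hq : forall n : nat, (1 <= n)%N -> 0 < q n < 1.

Lemma cantor_intervalsS n (I : R * R) :
  reflect (exists2 J, J \in cantor_intervals q n &
     I = (J.1, J.1 + (1 - q n.+1) / 2 * (J.2 - J.1)) \/
     I = (J.2 - (1 - q n.+1) / 2 * (J.2 - J.1), J.2))
    (I \in cantor_intervals q n.+1).
Proof.
apply: (iffP flatten_mapP) => -[J JI]; rewrite ?inE.
  by move=> /orP[/eqP ->|/eqP ->]; exists J => //; [left | right].
by case=> ->; exists J => //; rewrite !inE eqxx ?orbT.
Qed.

Let side_gt0 n (J : R * R) : J.1 < J.2 ->
  0 < (1 - q n.+1) / 2 * (J.2 - J.1) /\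
  2 * ((1 - q n.+1) / 2 * (J.2 - J.1)) < J.2 - J.1.
Proof.
move=> J12; have /andP[q0 q1] := hq (ltn0Sn n).
have J0 : 0 < J.2 - J.1 by rewrite subr_gt0.
split; first by rewrite !mulr_gt0 ?invr_gt0 ?subr_gt0.
have : 0 < q n.+1 * (J.2 - J.1) by rewrite mulr_gt0.
lra.
Qed.

Lemma cantor_interval_lt n I : I \in cantor_intervals q n ->
  0 <= I.1 /\ I.1 < I.2 <= 1.
Proof.
elim: n I => [|n IH] I; first by rewrite inE => /eqP -> /=; lra.
move=> /cantor_intervalsS [J /IH [J0 /andP[J12 J1]] [] -> /=];
  have [] := side_gt0 n J12; lra.
Qed.

Lemma cantor_interval_length n I : I \in cantor_intervals q n ->
  I.2 - I.1 <= 2^-1 ^+ n.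
Proof.
elim: n I => [|n IH] I; first by rewrite inE => /eqP -> /=; rewrite subr0 expr0 lexx.
move=> /cantor_intervalsS [J JI IE].
have [_ /andP[J12 _]] := cantor_interval_lt JI.
have [s0 s1] := side_gt0 n J12; have := IH _ JI; rewrite exprSr.
by case: IE => -> /=; lra.
Qed.

Lemma cantor_interval_disjoint n I J x :
  I \in cantor_intervals q n -> J \in cantor_intervals q n ->
  I.1 <= x <= I.2 -> J.1 <= x <= J.2 -> I = J.
Proof.
elim: n I J => [|n IH] I J; first by rewrite !inE => /eqP -> /eqP ->.
move=> /cantor_intervalsS [I' I'n IE] /cantor_intervalsS [J' J'n JE] xI xJ.
have [_ /andP[I12 _]] := cantor_interval_lt I'n.
have [_ /andP[J12 _]] := cantor_interval_lt J'n.
have [s0 s1] := side_gt0 n I12; have [t0 t1] := side_gt0 n J12.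
have E : I' = J'.
  apply: IH => //; first by case: IE xI => -> /=; lra.
  by case: JE xJ => -> /=; lra.
by subst J'; case: IE xI => -> /= xI; case: JE xJ => -> //= xJ; exfalso; lra.
Qed.

Lemma cantor_level_sub n : (1 <= n)%N ->
  cantor_set q `<=` cantor_level q n.
Proof. by move=> n1 x; apply. Qed.

Lemma cantor_level_antitone n : cantor_level q n.+1 `<=` cantor_level q n.
Proof.
move=> x [I /cantor_intervalsS [J JI IE] xI]; exists J => //.
have [_ /andP[J12 _]] := cantor_interval_lt JI.
have [s0 s1] := side_gt0 n J12.
by case: IE xI => -> /=; lra.
Qed.

(** By induction the segment lies in one interval of level n. The midpoint of that interval is
    removed at the next level, so the segment lies entirely on one side of it. *)
Lemma segment_in_cantor_level n u v : u < v ->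
  (forall x, u <= x <= v -> cantor_level q n x) ->
  exists2 I, I \in cantor_intervals q n & I.1 <= u /\ v <= I.2.
Proof.
move=> uv; elim: n => [|n IH] lev.
  have [I II uI] := lev u ltac:(lra); have [J JI vJ] := lev v ltac:(lra).
  exists I => //; move: II JI uI vJ; rewrite !inE => /eqP -> /eqP -> /=; lra.
have [I II [Iu vI]] := IH (fun x xuv => cantor_level_antitone (lev x xuv)).
have [_ /andP[I12 _]] := cantor_interval_lt II.
have [s0 s1] := side_gt0 n I12.
set s := (1 - q n.+1) / 2 * (I.2 - I.1) in s0 s1.
have child x : u <= x <= v -> x <= I.1 + s \/ I.2 - s <= x.
  move=> xuv; have [K /cantor_intervalsS [J JI KE] xK] := lev x xuv.
  have [_ /andP[J12 _]] := cantor_interval_lt JI.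
  have [t0 t1] := side_gt0 n J12.
  have JE : J = I.
    apply: (cantor_interval_disjoint (x := x) JI II); last lra.
    by case: KE xK => -> /=; lra.
  by subst J; case: KE xK => -> /=; rewrite -/s; lra.
pose m := (I.1 + I.2) / 2.
have mout : ~ (u <= m <= v) by move=> /child; rewrite /m; lra.
have [vm|mv] := ltP v m.
  exists (I.1, I.1 + s); first by apply/cantor_intervalsS; exists I => //; left.
  by split => //=; have := child v ltac:(lra); move: vm; rewrite /m; lra.
have mu : m < u by rewrite ltNge; apply/negP => um; apply: mout; rewrite um mv.
exists (I.2 - s, I.2); first by apply/cantor_intervalsS; exists I => //; right.
by split => //=; have := child u ltac:(lra); move: mu; rewrite /m; lra.
Qed.

(** A segment inside the Cantor set would fit in an interval of each level, of length at most
    2^-n. *)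
Lemma cantor_gap u v : u < v -> exists x, u < x < v /\ ~ cantor_set q x.
Proof.
move=> uv; apply: contrapT => no.
have all_in x : u < x < v -> cantor_set q x.
  by move=> xuv; apply: contrapT => nx; apply: no; exists x.
(* The middle third, a closed segment inside the open interval from u to v. *)
pose a := u + (v - u) / 3; pose b := u + 2 * ((v - u) / 3).
(* The exponent is a successor because the Cantor set is an intersection over levels n >= 1. *)
have [n hn] : exists n, 2^-1 ^+ n.+1 < b - a.
  have : ((2^-1 : R) ^+ n @[n --> \oo] --> (0 : R)).
    by apply: cvg_expr; rewrite ger0_norm; lra.
  have ab : 0 < b - a by rewrite /a /b; lra.
  move/cvgrPdist_lt => /(_ _ ab) [n _ /(_ n.+1 (leqnSn n))].
  by rewrite /= sub0r normrN ger0_norm ?exprn_ge0 ?invr_ge0 // => ?; exists n.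
have [|x xab|I II [Ia bI]] := @segment_in_cantor_level n.+1 a b.
- by rewrite /a /b; lra.
- by apply: cantor_level_sub => //; apply: all_in; move: xab; rewrite /a /b; lra.
by have := cantor_interval_length II; lra.
Qed.

Lemma cantor_set_unit x : cantor_set q x -> 0 <= x <= 1.
Proof.
move=> /(cantor_level_sub (leqnn 1)) [I II xI].
by have [I0 /andP[_ I1]] := cantor_interval_lt II; lra.
Qed.

End CantorGaps.

(** * Boundary behaviour of the covering map on a thin strip *)

Section StripArgument.
Variables (R : realType) (q : nat -> R).
Local Notation C := (cplx R).
Local Notation md := (@modulus R).
Local Notation pt := (@cpoint R).
Local Notation X := (cantor_complement q).
Implicit Types (z w : C) (t : R).
Hypothesis hq : forall n : nat, (1 <= n)%N -> 0 < q n < 1.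

Variables (a : R) (F : C -> sphere R).
Hypothesis a0 : 0 < a.

Definition strip a t w := `|complex.Re w| <= a /\ 0 < complex.Im w < t.

Local Notation S := (strip a).
(** The value 0 at infinity is a default; estimates on [val w] go with [F w = Some (val w)]. *)
Let val w : C := if F w is Some z then z else 0.

Hypothesis FX : forall w, S a w -> X (F w).
Hypothesis Fc : forall w, S a w -> {for w, continuous F}.
Hypothesis Fd : forall w, S a w -> F w = Some (val w) -> derivable val w 1.
Hypothesis Favoid : forall p, X p -> exists N t,
  [/\ nbhs p N, 0 < t <= a & forall w, S t w -> ~ N (F w)].

Let stripW t t' w : t <= t' -> S t w -> S t' w.
Proof. by move=> tt [w1 /andP[w2 w3]]; split=> //; rewrite w2 (lt_le_trans w3). Qed.

Let ge_minl (s t : R) : Num.min s t <= s. Proof. by rewrite ge_min lexx. Qed.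

Let ge_minr (s t : R) : Num.min s t <= t. Proof. by rewrite ge_min lexx orbT. Qed.

Let strip_point t : 0 < t -> S t (pt 0 (t / 2)).
Proof. by move=> t0; split; rewrite /= ?normr0 ?(ltW a0) //; lra. Qed.

(** Otherwise values of F outside O occur at arbitrarily small heights and, the sphere being
    compact, cluster at some p. If p is in X this contradicts [Favoid]; if not, O is itself a
    neighbourhood of p. *)
Lemma strip_near_complement (O : set (sphere R)) :
  (forall p, ~ X p -> nbhs p O) ->
  exists2 t, 0 < t <= a & forall w, S t w -> O (F w).
Proof.
move=> hO; apply: contrapT => no.
pose G := filter_from [set t | 0 < t <= a] (fun t => [set F w | w in [set w | S t w /\ ~ O (F w)]]).
have GF : ProperFilter G.
  apply: filter_from_proper.
    apply: filter_from_filter; first by exists a; rewrite /= a0 lexx.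
    move=> i j /= /andP[i0 ia] /andP[j0 ja]; exists (Num.min i j).
      by rewrite /= lt_min i0 j0 /= ge_min ia.
    move=> _ [w [Sw Ow] <-]; split; exists w => //; split=> //;
      by apply: stripW Sw; rewrite ge_min lexx ?orbT.
  move=> t /= t0; apply: contrapT => ne; apply: no; exists t => // w Sw.
  by apply: contrapT => Ow; apply: ne; exists (F w), w.
have [p [_ cl]] := @one_point_compactification_compact C G GF filterT.
have [Xp|Xp] := pselect (X p).
  have [N [t [Np t0 hN]]] := Favoid Xp.
  have Gt : G [set F w | w in [set w | S t w /\ ~ O (F w)]] by exists t.
  have [_ [[w [Sw _] <-] NF]] := cl _ N Gt Np; exact: hN NF.
have Ga : G [set F w | w in [set w | S a w /\ ~ O (F w)]].
  by exists a; rewrite /= ?a0 ?lexx.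
have [_ [[w [Sw Ow] <-] OF]] := cl _ O Ga (hO _ Xp); exact: Ow OF.
Qed.

Let not_complement p : ~ X p -> exists2 x, cantor_set q x & p = Some x%:C%C.
Proof. by move=> /contrapT [x Ex <-]; exists x. Qed.

(** When t is not in the Cantor set, the finite points off the vertical line through t form a
    neighbourhood of every point outside X. *)
Lemma strip_real_part_neq t : ~ cantor_set q t ->
  exists2 s, 0 < s <= a & forall w, S s w ->
    F w = Some (val w) /\ complex.Re (val w) != t.
Proof.
move=> Et.
have [p /not_complement [x Ex ->]|s s0 hs] :=
    @strip_near_complement [set Some z | z in [set z | complex.Re z != t]].
  apply/nbhs_someP; exists `|x - t|.
    rewrite normr_gt0 subr_eq0; apply/eqP => xt; apply: Et; by rewrite -xt.
  move=> w wx; exists w => //=; apply/eqP => wt.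
  have := le_lt_trans (Re_le_modulus _) wx.
  have -> : complex.Re (w - x%:C%C) = t - x by rewrite -wt; case: w {wx wt}.
  by rewrite distrC ltxx.
by exists s => // w /hs [z /= zt Fw]; rewrite /val -Fw.
Qed.

Let val_continuous w : S a w -> F w = Some (val w) ->
  forall e, 0 < e -> exists2 d, 0 < d & forall w', md (w' - w) < d ->
    `|complex.Re (val w') - complex.Re (val w)| < e.
Proof.
move=> Sw Fw e e0.
have : nbhs (F w) [set Some z | z in [set z | md (z - val w) < e]].
  by rewrite Fw; apply/nbhs_someP; exists e => // z ze; exists z.
move=> /(Fc Sw) /nbhs_modulusP [d d0 hd]; exists d => // w' /hd [z /= ze Fw'].
rewrite {1}/val -Fw'; apply: le_lt_trans ze.
by rewrite (le_trans _ (Re_le_modulus _)) //; case: (z) => ? ?; case: (val w).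
Qed.

(** The strip is convex, so the intermediate value theorem on the segment from w1 to w2 would
    produce the forbidden real part t. *)
Lemma strip_real_part_sign t s w1 w2 : 0 < s <= a ->
  (forall w, S s w -> F w = Some (val w) /\ complex.Re (val w) != t) ->
  S s w1 -> S s w2 -> complex.Re (val w1) < t -> complex.Re (val w2) < t.
Proof.
move=> /andP[s0 sa] hs S1 S2 lt1; rewrite ltNge; apply/negP => ge2.
pose path (x : R) := w1 + x%:C%C * (w2 - w1).
pose g x := complex.Re (val (path x)).
have Spath x : 0 <= x <= 1 -> S s (path x).
  move=> x01; case: S1 S2 => [r1 i1] [r2 i2]; split.
    by move: r1 r2; rewrite Re_segment !ler_norml; nra.
  rewrite Im_segment.
  by have [le12|/ltW le21] := lerP (complex.Im w1) (complex.Im w2); nra.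
have gc : {within `[0, 1], continuous g}.
  apply: continuous_in_subspaceT => x; rewrite inE /= in_itv /= => x01.
  apply/(@cvgrPdist_lt _ R^o) => e e0.
  have [Fx _] := hs _ (Spath x x01).
  have [d d0 hd] := val_continuous (stripW sa (Spath x x01)) Fx e0.
  have D0 : 0 < md (w2 - w1) + 1 by rewrite ltr_wpDl ?modulus_ge0.
  apply/nbhs_ballP; exists (d / (md (w2 - w1) + 1)) => [|y]; first by rewrite /= divr_gt0.
  rewrite /ball /= ltr_pdivlMr // => xy.
  rewrite distrC; apply: hd.
  have -> : path y - path x = (y - x)%:C%C * (w2 - w1).
    by rewrite /path rmorphB /=; ring.
  rewrite modulusM modulus_real distrC; apply: le_lt_trans xy.
  by rewrite ler_wpM2l // lerDl.
have g0 : g 0 < t by rewrite /g /path mul0r addr0.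
have g1 : t <= g 1 by rewrite /g /path mul1r subrKC.
have [|x x01 gx] := @IVT R g 0 1 t ler01 gc.
  by rewrite ge_min le_max (ltW g0) g1 orbT.
move: x01; rewrite in_itv /= => x01.
by have [_ /eqP] := hs _ (Spath x x01).
Qed.

(** The limit is found as a Dedekind cut: [A] collects the t outside the Cantor set that are
    eventually below the real part of F, and c = sup A. The imaginary part tends to 0 because the
    Cantor set is real. *)
Lemma strip_limit : exists c : R, forall e, 0 < e ->
  exists2 s, 0 < s <= a & forall w, S s w ->
    F w = Some (val w) /\ md (val w - c%:C%C) < e.
Proof.
pose A := [set t : R | ~ cantor_set q t /\ exists2 s, 0 < s <= a &
  forall w, S s w -> F w = Some (val w) /\ t < complex.Re (val w)].
have dich t : ~ cantor_set q t -> A t \/ exists2 s, 0 < s <= a &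
    forall w, S s w -> F w = Some (val w) /\ complex.Re (val w) < t.
  move=> Et; have [s sa hs] := strip_real_part_neq Et.
  have s0 : 0 < s by case/andP: sa.
  have S0 := strip_point s0.
  have [lt|ge] := ltP (complex.Re (val (pt 0 (s / 2)))) t.
    right; exists s => // w Sw; split; first by have [] := hs _ Sw.
    exact: (strip_real_part_sign sa hs S0 Sw lt).
  left; split=> //; exists s => // w Sw; have [Fw nt] := hs _ Sw; split=> //.
  rewrite lt_neqAle eq_sym nt /= leNgt; apply/negP => lt.
  by have := strip_real_part_sign sa hs Sw S0 lt; rewrite ltNge ge.
have A_lt t t' s : A t -> 0 < s ->
    (forall w, S s w -> F w = Some (val w) /\ complex.Re (val w) < t') -> t < t'.
  move=> [_ [s' /andP[s'0 _] h']] s0 h.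
  have m0 : 0 < Num.min s s' by rewrite lt_min s0.
  have Sm := strip_point m0.
  have [_ +] := h _ (stripW (ge_minl s s') Sm).
  have [_ +] := h' _ (stripW (ge_minr s s') Sm).
  exact: lt_trans.
have box e : 0 < e -> exists2 s, 0 < s <= a & forall w, S s w ->
    F w = Some (val w) /\ [/\ -1 < complex.Re (val w), complex.Re (val w) < 2 &
      `|complex.Im (val w)| < e].
  move=> e0.
  have [p /not_complement [x Ex ->]|s s0 hs] := @strip_near_complement
      [set Some z | z in [set z | [/\ -1 < complex.Re z, complex.Re z < 2 & `|complex.Im z| < e]]].
    apply/nbhs_someP; exists (Num.min 1 e); first by rewrite lt_min ltr01.
    move=> w; rewrite lt_min => /andP[w1 we]; exists w => //=.
    have := le_lt_trans (Re_le_modulus _) w1.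
    have := le_lt_trans (Im_le_modulus _) we.
    have := cantor_set_unit hq Ex.
    case: w {w1 we} => u v /=; rewrite oppr0 addr0 => x01 ve; rewrite ltr_norml => ux.
    by split=> //; lra.
  by exists s => // w /hs [z /= zt Fw]; rewrite /val -Fw.
have Am1 : A (-1).
  split; first by move=> /(cantor_set_unit hq); lra.
  by have [s s0 hs] := box 1 ltr01; exists s => // w /hs [Fw []].
have Aub : ubound A 2.
  move=> t At; have [s /andP[s0 _] hs] := box 1 ltr01.
  by apply: ltW; apply: (A_lt _ _ s At s0) => w /hs [? []].
have hsA : has_sup A by split; [exists (-1) | exists 2].
exists (sup A) => e e0.
have e20 : 0 < e / 2 by lra.
have [t1 [_ [s1 /andP[s10 s1a] h1]] lt1] := sup_adherent e20 hsA.
have lt0 : sup A < sup A + e / 2 by rewrite ltrDl.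
(* Gaps are dense, so some t2 slightly above sup A is outside the Cantor set; not being in [A], it
   is eventually above the real part. *)
have [t2 [/andP[lo2 hi2] Et2]] := cantor_gap hq lt0.
have [A2|[s2 /andP[s20 _] h2]] := dich _ Et2.
  have : t2 <= sup A by apply: ub_le_sup; [exact: hsA.2 | exact: A2].
  by lra.
have [s3 /andP[s30 _] h3] := box _ e20.
pose s := Num.min s1 (Num.min s2 s3).
have sa : 0 < s <= a by rewrite !lt_min s10 s20 s30 ge_min s1a.
have [le1 le2 le3] : [/\ s <= s1, s <= s2 & s <= s3].
  by split; rewrite !ge_min lexx ?orbT.
exists s => // w Sw.
have [Fw r1] := h1 _ (stripW le1 Sw).
have [_ r2] := h2 _ (stripW le2 Sw).
have [_ [_ _ r3]] := h3 _ (stripW le3 Sw).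
split=> //; apply: le_lt_trans (modulus_le_ReIm _) _.
have -> : complex.Re (val w - (sup A)%:C%C) = complex.Re (val w) - sup A.
  by case: (val w).
have -> : complex.Im (val w - (sup A)%:C%C) = complex.Im (val w).
  by case: (val w) => ? ? /=; rewrite oppr0 addr0.
have : `|complex.Re (val w) - sup A| < e / 2 by rewrite ltr_norml; lra.
lra.
Qed.

(** One zero of F - c suffices: it puts c in X, where [Favoid] forbids F to converge to c. *)
Lemma strip_contradiction : False.
Proof.
have [c hc] := strip_limit.
have [t /andP[t0 ta] ht] := hc 1 ltr01.
have t20 : 0 < t / 2 by lra.
pose f : C -> C := val - cst c%:C%C.
have fE w : f w = val w - c%:C%C by [].
have f0 : f (pt 0 (t / 2)) = 0.
  apply: (@vanishing_boundary_value R f a (t / 2)) => //; first lra.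
    move=> w w1 w2; have Sw : S t w by split=> //; move: w2; lra.
    have [Fw wc] := ht _ Sw; split; last by rewrite fE ltW.
    apply: derivableB; last exact: derivable_cst.
    by apply: Fd => //; exact: stripW Sw.
  move=> e e0; have [s /andP[s0 sa] hs] := hc e e0; exists s => // w w1 w2.
  by have [] := hs w; [split | move=> _; rewrite fE => /ltW].
have S0 := strip_point t0.
have [F0 _] := ht _ S0.
have v0 : val (pt 0 (t / 2)) = c%:C%C by apply/eqP; rewrite -subr_eq0 -fE f0.
have Xc : X (Some c%:C%C) by rewrite -v0 -F0; apply: FX; exact: stripW S0.
have [N [s [/nbhs_someP [d d0 hd] /andP[s0 sa] hN]]] := Favoid Xc.
have [r /andP[r0 ra] hr] := hc d d0.
have m0 : 0 < Num.min r s by rewrite lt_min r0.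
have Sm := strip_point m0.
have [Fm vm] := hr _ (stripW (ge_minl r s) Sm).
have := hN _ (stripW (ge_minr r s) Sm).
by apply; rewrite Fm; exact: hd.
Qed.

End StripArgument.

(** * A Cayley transform centred at a boundary point *)

Section HalfPlane.
Variable R : realType.
Local Notation C := (cplx R).
Local Notation md := (@modulus R).
Local Notation pt := (@cpoint R).
Implicit Types w z : C.

(** With [pt 0 1] as i, this Moebius map sends 0 to zeta and i to 0. *)
Definition half_plane_map (zeta w : C) : C :=
  zeta * (1 + pt 0 1 * w) / (1 - pt 0 1 * w).

Variable zeta : C.
Hypothesis zeta1 : md zeta = 1.
Local Notation phi := (half_plane_map zeta).

Let num_sqr w : md (1 + pt 0 1 * w) ^+ 2 =
  (1 - complex.Im w) ^+ 2 + complex.Re w ^+ 2.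
Proof. by rewrite modulus_sqr; case: w => x y /=; ring. Qed.

Let den_sqr w : md (1 - pt 0 1 * w) ^+ 2 =
  (1 + complex.Im w) ^+ 2 + complex.Re w ^+ 2.
Proof. by rewrite modulus_sqr; case: w => x y /=; ring. Qed.

Let den_ge1 w : 0 < complex.Im w -> 1 <= md (1 - pt 0 1 * w).
Proof.
move=> w0; rewrite -(ler_pXn2r (n := 2)) ?nnegrE ?modulus_ge0 // expr1n den_sqr.
by have := sqr_ge0 (complex.Re w); nra.
Qed.

Lemma half_plane_den_neq0 w : 0 < complex.Im w -> 1 - pt 0 1 * w != 0.
Proof. by move=> /den_ge1 h; rewrite -modulus_gt0; apply: lt_le_trans h. Qed.

(** Exactly, 1 - |phi w|^2 = 4 Im w / |1 - iw|^2, and the denominator is at least 1 on the upper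
    half-plane. *)
Lemma half_plane_depth w : 0 < complex.Im w ->
  0 < 1 - md (phi w) ^+ 2 <= 4 * complex.Im w.
Proof.
move=> w0; have d1 := den_ge1 w0.
have d0 : 0 < md (1 - pt 0 1 * w) ^+ 2 by rewrite exprn_gt0 // (lt_le_trans ltr01).
have d2 : 1 <= md (1 - pt 0 1 * w) ^+ 2 by rewrite expr_ge1 ?modulus_ge0.
have -> : 1 - md (phi w) ^+ 2 = 4 * complex.Im w / md (1 - pt 0 1 * w) ^+ 2.
  rewrite /phi !modulusM modulusV zeta1 mul1r expr_div_n num_sqr den_sqr.
  by field; rewrite -den_sqr gt_eqF.
apply/andP; split; first by rewrite divr_gt0 // mulr_gt0.
by rewrite ler_pdivrMr // ler_peMr // mulr_ge0 // ltW.
Qed.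

Lemma half_plane_in_disk w : 0 < complex.Im w -> md (phi w) < 1.
Proof.
move=> /half_plane_depth /andP[h _]; rewrite ltNge; apply/negP => h1.
by have := modulus_ge0 (phi w); nra.
Qed.

Lemma half_plane_near w : 0 < complex.Im w -> md (phi w - zeta) <= 2 * md w.
Proof.
move=> w0; have d1 := den_ge1 w0.
have -> : phi w - zeta = zeta * (2 * pt 0 1) * w / (1 - pt 0 1 * w).
  by rewrite /phi; field; exact: half_plane_den_neq0.
have i1 : md (pt 0 1) = 1.
  apply/eqP; rewrite -(eqrXn2 (n := 2)) ?modulus_ge0 //.
  by rewrite modulus_sqr /= expr0n add0r.
rewrite !modulusM modulusV zeta1 modulus_nat i1 mul1r mulr1.
rewrite ler_pdivrMr; last exact: lt_le_trans d1.
by rewrite ler_peMr // mulr_ge0 // modulus_ge0.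
Qed.

Lemma derivable_half_plane w : 0 < complex.Im w -> derivable phi w 1.
Proof.
move=> w0.
have dl (c : C) : derivable (cst 1 + cst c * id : C -> C) w 1.
  apply: derivableD; first exact: derivable_cst.
  by apply: derivableM; [exact: derivable_cst | exact: derivable_id].
have -> : phi = (cst zeta * (cst 1 + cst (pt 0 1) * id)) *
    (fun z => ((cst 1 + cst (- pt 0 1) * id : C -> C) z)^-1).
  by apply/funext => z; rewrite /half_plane_map -mulNr.
apply: derivableM.
  by apply: derivableM; [exact: derivable_cst | exact: dl].
apply: derivableV; last exact: dl.
by have := half_plane_den_neq0 w0; rewrite -mulNr.
Qed.

End HalfPlane.

(** * The covering map near a boundary point off the limit set *)

Section DiskQuotient.
Variables (R : realType) (X : set (sphere R)).
Variable Gamma : set (sphere R -> sphere R).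
Local Notation C := (cplx R).
Local Notation md := (@modulus R).
Implicit Types w z : C.
Hypothesis FG : fuchsian Gamma.

Variable Phi : set (sphere R) -> sphere R.
Hypothesis Phi_bij : set_bij (disk_quotient Gamma) X Phi.
Hypothesis Phi_sec : forall x, X x -> exists s : sphere R -> sphere R,
  \forall y \near x, [/\ holomorphic_at s y, unit_disk (s y) &
    Phi (group_orbit Gamma (s y)) = y].
Local Notation f := (Phi \o group_orbit Gamma).

Lemma quotient_map_in x : unit_disk x -> X (f x).
Proof. by move=> Dx; case: Phi_bij => sub _ _; apply: sub; exists x. Qed.

Lemma quotient_map_fiber x y : unit_disk x -> unit_disk y -> f x = f y ->
  exists2 g, Gamma g & y = g x.
Proof.
move=> Dx Dy fxy; case: Phi_bij => _ inj _.
have E : group_orbit Gamma y = group_orbit Gamma x.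
  by apply: inj; rewrite ?inE //; [exists y | exists x].
have [[id_in _ _] _ _] := FG.
have : group_orbit Gamma y y by exists id.
by rewrite E => -[g Gg gx]; exists g.
Qed.

(* If z lies over a point near p, then z = g v for some g in Gamma and some v
   in a fixed compact subset of the disk, so g moves 0 to a point close to z. *)
Lemma quotient_map_avoid (zeta : C) (r : R) : 0 < r ->
  (forall g w, Gamma g -> g (Some (0 : C)) = Some w -> r <= md (w - zeta)) ->
  forall p, X p -> exists N d, [/\ nbhs p N, 0 < d &
    forall z, md z < 1 -> md (z - zeta) < r / 2 -> 1 - md z ^+ 2 < d ->
      ~ N (f (Some z))].
Proof.
move=> r0 far p Xp; have [s hs] := Phi_sec Xp.
have [[sc _] sD _] := nbhs_singleton hs.
case E : (s p) sD sc => [v0|]; last by case.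
move=> /unit_diskP v01 sc.
pose rho := (1 + md v0) / 2.
have v00 := modulus_ge0 v0.
have [rho0 rho1] : 0 < rho /\ rho < 1 by rewrite /rho; split; lra.
have nv : nbhs (s p) [set Some v | v in [set v : C | md v < rho]].
  rewrite E; apply/nbhs_someP; exists (rho - md v0); first by rewrite /rho; lra.
  move=> v vv; exists v => //=; have := modulus_subr_le v v0; lra.
exists (s @^-1` [set Some v | v in [set v : C | md v < rho]] `&`
  [set y | unit_disk (s y) /\ f (s y) = y]).
(* By [unitary_displacement], |z - g 0|^2 (1 - rho^2) <= 1 - |z|^2, so this depth forces |z - g 0| <
   r / 2. *)
exists ((r / 2) ^+ 2 * (1 - rho ^+ 2)).
have rr : 0 < 1 - rho ^+ 2 by nra.
split; first apply: filterI.
- exact: sc.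
- by apply: filterS hs => y [].
- by rewrite mulr_gt0 // exprn_gt0 // divr_gt0.
move=> z z1 zz zd [[v /= vr sv] [_ fs]].
have Dz : unit_disk (Some z : sphere R) by apply/unit_diskP.
have v1 : md v < 1 by lra.
have Dv : unit_disk (Some v : sphere R) by apply/unit_diskP.
rewrite -sv in fs.
have [g Gg gv] := quotient_map_fiber Dv Dz fs.
have [_ act _] := FG; have [[A dA gA] _] := act _ Gg.
have GA : Gamma (mobius A) by rewrite -gA.
have [c01 d01 ab] := fuchsian_unitary FG dA GA.
have zE : z = (A 0 0 * v + A 0 1) / ((A 0 1)^* * v + (A 0 0)^*).
  by move: gv; rewrite gA /= c01 d01 (negPf (unitary_denom_neq0 ab v1)) => -[].
have n0 : (A 0 0)^* != 0.
  have := unitary_denom_neq0 (z := 0) ab; rewrite mulr0 add0r; apply.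
  by rewrite modulus0.
have g0 : g (Some (0 : C)) = Some (A 0 1 / (A 0 0)^*).
  by rewrite gA /= c01 d01 !mulr0 !add0r (negPf n0).
have := unitary_displacement ab v1; rewrite -zE => disp.
have := far _ _ Gg g0; rewrite leNgt => /negP; apply.
set g0' := A 0 1 / (A 0 0)^* in disp *.
have h : md (z - g0') < r / 2.
  rewrite -(ltr_pXn2r (n := 2)) ?nnegrE ?modulus_ge0 ?divr_ge0 ?(ltW r0) //.
  rewrite -(ltr_pM2r rr); apply: le_lt_trans zd; apply: le_trans disp.
  rewrite ler_wpM2l ?sqr_ge0 // lerD2l lerN2.
  by rewrite ler_pXn2r ?nnegrE ?modulus_ge0 // ltW.
by have := modulus_triangle g0' z zeta; rewrite (modulusB g0' z); lra.
Qed.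

End DiskQuotient.

(** * Accumulation of the orbit of 0 at each point of the circle *)

Theorem proposition1p5 (R : realType) (q : nat -> R)
    (hq : forall n : nat, (1 <= n)%N -> 0 < q n < 1)
    (Gamma : set (sphere R -> sphere R)) :
  fuchsian Gamma -> torsion_free Gamma ->
  is_disk_quotient (cantor_complement q) Gamma ->
  first_kind Gamma.
Proof.
move=> FG _ [Phi [bij hol sec]].
apply/seteqP; split; first exact: limit_set_sub_circle.
case=> [zeta|[]//] /unit_circleP zeta1.
apply: contrapT => nlim.
have [r r0 far] : exists2 r : R, 0 < r & forall g w, Gamma g ->
    g (Some (0 : cplx R)) = Some w -> r <= modulus (w - zeta).
  apply: contrapT => no; apply: nlim.
  have D0 : unit_disk (Some (0 : cplx R) : sphere R).
    by apply/unit_diskP; rewrite modulus0.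
  exists (Some (0 : cplx R)) => // U /nbhs_someP [d d0 dU].
  apply: contrapT => nU; apply: no; exists d => // g w Gg gw.
  rewrite leNgt; apply/negP => wd; apply: nU; exists (Some w); split.
  (* A limit point requires orbit points different from zeta; the orbit of 0 lies in the open disk,
     so this is automatic. *)
  - apply/eqP => -[wz]; have := fuchsian_disk FG (Some 0) Gg.
    rewrite gw => -[_ /(_ D0) /unit_diskP]; by rewrite wz zeta1 ltxx.
  - by exists g.
  - exact: dU.
(* On the strip |w| <= 2 * a, so the disk point is within 4 * a = r / 4 of zeta, less than the r / 2
   required. *)
pose a := r / 16.
have a0 : 0 < a by rewrite /a; lra.
pose F w : sphere R := Phi (group_orbit Gamma (Some (half_plane_map zeta w))).
have inD w : strip a a w -> unit_disk (Some (half_plane_map zeta w) : sphere R).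
  by case=> _ /andP[w0 _]; apply/unit_diskP; exact: half_plane_in_disk.
apply: (@strip_contradiction R q hq a F a0).
- by move=> w /inD; exact: quotient_map_in.
- move=> w Sw; have [fc _] := hol _ (inD _ Sw).
  have phic : {for w, continuous (half_plane_map zeta)}.
    by apply: derivable1_continuous; apply: derivable_half_plane; case: Sw => _ /andP[].
  by move=> U FU; exact: (phic _ (fc _ FU)).
- move=> w Sw Fw; have [_ fd] := hol _ (inD _ Sw).
  have w0 : 0 < complex.Im w by case: Sw => _ /andP[].
  (* The value at w is finite, so the chart around it is the finite one and reads the coordinate. *)
  have fd' : derivable (fun z : cplx R =>
      if Phi (group_orbit Gamma (Some z)) is Some y then y else 0)
      (half_plane_map zeta w) 1.
    have [v Fv] : exists v,
        Phi (group_orbit Gamma (Some (half_plane_map zeta w))) = Some v.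
      by eexists; exact: Fw.
    by move: fd; rewrite /comp Fv.
  exact: (derivable_comp1 (derivable_half_plane (zeta := zeta) w0) fd').
move=> p Xp.
have [N [d [Np d0 hN]]] := quotient_map_avoid FG bij sec r0 far Xp.
(* By [half_plane_depth], Im w < d / 8 gives 1 - |phi w|^2 < d / 2. *)
exists N, (Num.min a (d / 8)); split=> //.
  by rewrite lt_min a0 divr_gt0 // ge_min lexx.
move=> w [w1 /andP[w0]]; rewrite lt_min => /andP[wa wd]; apply: hN.
- exact: half_plane_in_disk.
- apply: le_lt_trans (half_plane_near zeta1 w0) _.
  have := modulus_le_ReIm w; rewrite (gtr0_norm w0).
  by move: w1 wa; rewrite /a; lra.
- by have /andP[_] := half_plane_depth zeta1 w0; lra.
Qed.
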